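(* Let $\tau$ be any Polish topology on $\mathcal{P}_1(\ell_2)$ lying between WOT and SOT$^*$ (that is, $\mathrm{WOT}\subseteq\tau\subseteq \mathrm{SOT}^*$). Then a typical $T\in(\mathcal{P}_1(\ell_2),\tau)$ has a non-trivial invariant subspace.
   Context: $\ell_2=\ell_2(\mathbb{Z}_+)$ is the complex sequence space, $\mathbb{Z}_+=\{0,1,2,\dots\}$, with canonical basis $(e_n)_{n\ge 0}$. A vector $x=\sum_n x_n e_n$ is positive ($x\ge 0$) if $x_n\ge 0$ for all $n$; a bounded operator $T$ on $\ell_2$ is positive if $Tx\ge 0$ whenever $x\ge 0$. $\mathcal{P}_1(\ell_2)$ denotes the set of all positive operators $T$ on $\ell_2$ with $\|T\|\le 1$. The topologies on $\mathcal{P}_1(\ell_2)$ (each is Polish there): WOT: $T_i\to T$ iff $\langle y,T_ix\rangle\to\langle y,Tx\rangle$ for all $x,y$; SOT$^*$: $T_i\to T$ iff $\|T_ix-Tx\|\to 0$ and $\|T_i^*x-T^*x\|\to 0$ for all $x$. A property (P) is satisfied by a typical $T\in(\mathcal{P}_1(\ell_2),\tau)$ if the set of $T\in\mathcal{P}_1(\ell_2)$ satisfying (P) is comeager in $(\mathcal{P}_1(\ell_2),\tau)$, i.e. contains a $\tau$-dense $G_\delta$ subset. A non-trivial invariant subspace of $T$ is a closed linear subspace $V$ with $V\neq\{0\}$, $V\ne\ell_2$ and $T(V)\subseteq V$. *)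

(* Defs.v *)
From HB Require Import structures.
From mathcomp Require Import all_boot all_order all_algebra.
From mathcomp Require Import all_classical all_reals all_analysis.
From mathcomp Require Import borel_hierarchy.
From mathcomp Require Import complex.
From mathcomp Require Import ring lra.
Import Order.TTheory GRing.Theory Num.Theory.
Import numFieldNormedType.Exports.
Import ComplexField.

Set Implicit Arguments.
Unset Strict Implicit.
Unset Printing Implicit Defensive.

Local Open Scope classical_set_scope.
Local Open Scope ring_scope.
Local Open Scope complex_scope.

Section square_summable.
Variable R : realType.
Implicit Types x y : nat -> R[i].

Definition sq_norms x : R ^nat := fun n => Normc.normc (x n) ^+ 2.

Definition square_summable x : Prop := cvgn (series (sq_norms x)).

Definition square_summableb : {pred nat -> R[i]} :=
  fun x => `[< square_summable x >].

Lemma normc_ge0 (z : R[i]) : 0 <= Normc.normc z.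
Proof. by case: z => a b; rewrite /= sqrtr_ge0. Qed.

Lemma sq_norms_ge0 x n : 0 <= sq_norms x n.
Proof. exact: sqr_ge0. Qed.

Lemma nondecreasing_sq_norms x : nondecreasing_seq (series (sq_norms x)).
Proof.
apply/nondecreasing_seqP => n; rewrite /series /= big_nat_recr //=.
by rewrite lerDl sq_norms_ge0.
Qed.

Lemma square_summable_bounded x (c : R) :
  (forall n, series (sq_norms x) n <= c) -> square_summable x.
Proof.
move=> xc; apply: nondecreasing_is_cvgn; first exact: nondecreasing_sq_norms.
by exists c => _ [n _ <-].
Qed.

Lemma series_sq_norms_ge0 x n : 0 <= series (sq_norms x) n.
Proof. by apply: sumr_ge0 => i _; exact: sq_norms_ge0. Qed.

(* The norm of a [normedModType R[i]] takes its values in [R[i]]; [norm2] is the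
   corresponding real number, see [ell2_normE]. *)
Definition norm2 x : R := Num.sqrt (limn (series (sq_norms x))).

Lemma norm2_ge0 x : 0 <= norm2 x. Proof. exact: sqrtr_ge0. Qed.

Lemma series_le_norm2 x n : square_summable x ->
  series (sq_norms x) n <= norm2 x ^+ 2.
Proof.
move=> xs; have xn : series (sq_norms x) n <= limn (series (sq_norms x)).
  by apply: nondecreasing_cvgn_le xs n; exact: nondecreasing_sq_norms.
by rewrite sqr_sqrtr // (le_trans _ xn) // series_sq_norms_ge0.
Qed.

Lemma norm2_le x (c : R) : 0 <= c ->
  (forall n, series (sq_norms x) n <= c ^+ 2) -> norm2 x <= c.
Proof.
move=> c0 xc; rewrite -(ger0_norm c0) -sqrtr_sqr ler_wsqrtr //.
apply: limr_le; first exact: square_summable_bounded xc.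
by apply: nearW => n.
Qed.

Lemma sq_normsD x y (a b : R) n : 0 < a -> 0 < b ->
  series (sq_norms x) n <= a ^+ 2 -> series (sq_norms y) n <= b ^+ 2 ->
  series (sq_norms (x + y)) n <= (a + b) ^+ 2.
Proof.
move=> a0 b0 xa yb.
have h : series (sq_norms (x + y)) n <=
    (1 + b / a) * series (sq_norms x) n + (1 + a / b) * series (sq_norms y) n.
  rewrite /series /= !mulr_sumr -big_split /=; apply: ler_sum => k _.
  rewrite /sq_norms /=.
  set p := Normc.normc (x k); set q := Normc.normc (y k).
  have p0 : 0 <= p := normc_ge0 _; have q0 : 0 <= q := normc_ge0 _.
  have pq : Normc.normc ((x + y) k) <= p + q by exact: le_normcD.
  apply: (@le_trans _ _ ((p + q) ^+ 2)).
    by rewrite ler_sqr // nnegrE ?normc_ge0 ?addr_ge0.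
  rewrite -subr_ge0 (_ : _ - _ = (b * p - a * q) ^+ 2 / (a * b)); last first.
    by field; rewrite !gt_eqF.
  by rewrite divr_ge0 ?sqr_ge0 // mulr_ge0 // ltW.
apply: (le_trans h).
have -> : (a + b) ^+ 2 = (1 + b / a) * a ^+ 2 + (1 + a / b) * b ^+ 2.
  by field; rewrite !gt_eqF.
by apply: lerD; apply: ler_wpM2l; rewrite // addr_ge0 // divr_ge0 // ltW.
Qed.

Lemma norm2_bound_gt0 x (e : R) n : 0 < e -> square_summable x ->
  series (sq_norms x) n <= (norm2 x + e) ^+ 2.
Proof.
move=> e0 xs; apply: (le_trans (series_le_norm2 n xs)).
have := norm2_ge0 x; nra.
Qed.

Lemma square_summableD x y :
  square_summable x -> square_summable y -> square_summable (x + y).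
Proof.
move=> xs ys.
apply: (@square_summable_bounded _ ((norm2 x + 1 + (norm2 y + 1)) ^+ 2)) => n.
by apply: sq_normsD; rewrite ?ltr_wpDl ?norm2_ge0 //; exact: norm2_bound_gt0.
Qed.

Lemma ler_norm2D x y : square_summable x -> square_summable y ->
  norm2 (x + y) <= norm2 x + norm2 y.
Proof.
move=> xs ys; apply/ler_addgt0Pr => e e0.
have e2 : 0 < e / 2 by rewrite divr_gt0.
have -> : norm2 x + norm2 y + e = norm2 x + e / 2 + (norm2 y + e / 2) by field.
apply: norm2_le => [|n]; first by rewrite !addr_ge0 ?norm2_ge0 // ltW.
by apply: sq_normsD; rewrite ?ltr_wpDl ?norm2_ge0 //; exact: norm2_bound_gt0.
Qed.

Lemma series_sq_normsZ (a : R[i]) x :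
  series (sq_norms (a *: x)) = (Normc.normc a ^+ 2) *: series (sq_norms x).
Proof.
apply/funext => n.
transitivity (Normc.normc a ^+ 2 * series (sq_norms x) n); last by [].
rewrite /series /= mulr_sumr.
by apply: eq_bigr => k _; rewrite /sq_norms -exprMn -Normc.normcM.
Qed.

Lemma square_summableZ (a : R[i]) x :
  square_summable x -> square_summable (a *: x).
Proof.
by move=> xs; rewrite /square_summable series_sq_normsZ; exact: is_cvgZr.
Qed.

Lemma norm2Z (a : R[i]) x : square_summable x ->
  norm2 (a *: x) = Normc.normc a * norm2 x.
Proof.
move=> xs; rewrite /norm2 series_sq_normsZ limZr // sqrtrM ?sqr_ge0 //.
by rewrite sqrtr_sqr ger0_norm // normc_ge0.
Qed.

Lemma square_summable0 : square_summable (0 : nat -> R[i]).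
Proof.
apply: (@square_summable_bounded _ 0) => n; rewrite /series /= big1 // => i _.
by rewrite /sq_norms Normc.normc0 expr0n.
Qed.

Lemma norm2_eq0 x : square_summable x -> norm2 x = 0 -> x = 0.
Proof.
move=> xs x0; apply/funext => n; apply: Normc.eq0_normc.
have := series_le_norm2 n.+1 xs; rewrite x0 expr0n /= /series /=.
rewrite big_nat_recr //= => h.
have h2 : sq_norms x n <= 0.
  by apply: le_trans h; rewrite lerDr; exact: series_sq_norms_ge0.
apply/eqP; rewrite -sqrf_eq0; apply/eqP/le_anti.
by rewrite h2 sqr_ge0.
Qed.

Lemma square_summable_submod : submod_closed square_summableb.
Proof.
split; first by apply/asboolP; exact: square_summable0.
move=> a x y /asboolP xs /asboolP ys; apply/asboolP.
by apply: square_summableD => //; exact: square_summableZ.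
Qed.

HB.instance Definition _ :=
  GRing.isSubmodClosed.Build R[i] (nat -> R[i]) square_summableb
    square_summable_submod.

End square_summable.

Record ell2 (R : realType) := Ell2 {
  ell2_seq :> nat -> R[i];
  ell2P : ell2_seq \in @square_summableb R }.

HB.instance Definition _ (R : realType) := [isSub for @ell2_seq R].
HB.instance Definition _ (R : realType) := [Choice of ell2 R by <:].
HB.instance Definition _ (R : realType) :=
  [SubChoice_isSubLmodule of ell2 R by <:].

Section ell2_norm.
Variable R : realType.
Implicit Types x y : ell2 R.

Lemma ell2_summable x : square_summable x. Proof. exact/asboolP/(ell2P x). Qed.

Lemma ell2_norm_ler x y :
  (norm2 (x + y))%:C <= (norm2 x)%:C + (norm2 y)%:C :> R[i].
Proof.
by rewrite -rmorphD /= lecR; apply: ler_norm2D; exact: ell2_summable.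
Qed.

Lemma ell2_normZ (a : R[i]) x : (norm2 (a *: x))%:C = `|a| * (norm2 x)%:C.
Proof.
rewrite [ell2_seq _](_ : _ = a *: (x : nat -> R[i])) //.
by rewrite norm2Z ?rmorphM //; exact: ell2_summable.
Qed.

Lemma ell2_norm0 x : (norm2 x)%:C = 0 :> R[i] -> x = 0.
Proof.
move=> /complexI x0; apply: val_inj; apply: norm2_eq0 => //.
exact: ell2_summable.
Qed.

HB.instance Definition _ :=
  @Lmodule_isNormed.Build R[i] (ell2 R) (fun x => (norm2 x)%:C)
    ell2_norm_ler ell2_normZ ell2_norm0.
End ell2_norm.

Arguments ell2_summable {R} x _ _.

Section inner_product.
Variable R : realType.
Implicit Types x y z : ell2 R.

Definition dot x y : R[i] :=
  limn (series (fun n => x n * conjc (y n)) : nat -> R[i]^o).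

Lemma ell2_normE x : `|x| = (norm2 x)%:C. Proof. by []. Qed.

Lemma normc_normE (u : R[i]) : `|u| = (Normc.normc u)%:C. Proof. by []. Qed.

Lemma normcJ (u : R[i]) : Normc.normc (conjc u) = Normc.normc u.
Proof. by case: u => a b /=; rewrite sqrrN. Qed.

Lemma cvg_real_complex (u : R ^nat) (l : R) : u @ \oo --> l ->
  (fun n => (u n)%:C : R[i]^o) @ \oo --> (l%:C : R[i]^o).
Proof.
move=> ul; apply/cvgrPdist_lt => e e0.
have [r er] : exists r : R, e = r%:C by apply/complex_realP; exact: gtr0_real.
have r0 : 0 < r by rewrite -ltcR -er.
move/cvgrPdist_lt : ul => /(_ _ r0); apply: filterS => n.
rewrite er -rmorphB /= normc_normE ltcR /=.
by rewrite expr0n /= addr0 sqrtr_sqr.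
Qed.

Lemma Re_sum (u : nat -> R[i]) m n :
  complex.Re (\sum_(m <= k < n) u k) = \sum_(m <= k < n) complex.Re (u k).
Proof.
apply: (big_morph (@complex.Re R) (id1 := 0) (op1 := +%R)) => //.
by move=> [? ?] [? ?].
Qed.

Lemma Im_sum (u : nat -> R[i]) m n :
  complex.Im (\sum_(m <= k < n) u k) = \sum_(m <= k < n) complex.Im (u k).
Proof.
apply: (big_morph (@complex.Im R) (id1 := 0) (op1 := +%R)) => //.
by move=> [? ?] [? ?].
Qed.

Lemma normc_Re (u : R[i]) : `|complex.Re u| <= Normc.normc u.
Proof.
case: u => a b /=; rewrite -sqrtr_sqr ler_wsqrtr // lerDl; exact: sqr_ge0.
Qed.

Lemma normc_Im (u : R[i]) : `|complex.Im u| <= Normc.normc u.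
Proof.
case: u => a b /=; rewrite -sqrtr_sqr ler_wsqrtr // lerDr; exact: sqr_ge0.
Qed.

Lemma is_cvg_series_complex (u : nat -> R[i]) (c : R) :
  (forall n, \sum_(0 <= k < n) Normc.normc (u k) <= c) ->
  cvgn (series u : nat -> R[i]^o).
Proof.
move=> uc.
have cvgu (v : R ^nat) : (forall k, `|v k| <= Normc.normc (u k)) ->
    cvgn (series v).
  move=> vu; apply: normed_cvg.
  change (cvgn (fun n => \sum_(0 <= k < n) `|v k|)).
  apply: nondecreasing_is_cvgn.
    by apply/nondecreasing_seqP => n; rewrite [leRHS]big_nat_recr //= lerDl.
  exists c => _ [n _ <-]; apply: le_trans (uc n); apply: ler_sum => k _.
  exact: vu.
have /cvg_ex[a ua] := cvgu _ (fun k => normc_Re (u k)).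
have /cvg_ex[b ub] := cvgu _ (fun k => normc_Im (u k)).
apply/cvg_ex; exists (a%:C + 'i%C * b%:C).
rewrite (_ : series u = fun n => ((series (fun k => complex.Re (u k)) n)%:C : R[i]^o)
    + ('i%C : R[i]^o) *: ((series (fun k => complex.Im (u k)) n)%:C : R[i]^o)).
  apply: cvgD; first exact: cvg_real_complex.
  by apply: cvgZr; exact: cvg_real_complex.
apply/funext => n; rewrite [LHS]complexE /series /= Re_sum Im_sum.
by congr (_ + _).
Qed.

Lemma sum_CauchySchwarz x y n :
  \sum_(0 <= k < n) Normc.normc (x k) * Normc.normc (y k) <= norm2 x * norm2 y.
Proof.
have [x0|x0] := eqVneq (norm2 x) 0.
  rewrite x0 mul0r big1 // => k _.
  by rewrite (norm2_eq0 (ell2_summable x) x0) Normc.normc0 mul0r.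
have [y0|y0] := eqVneq (norm2 y) 0.
  rewrite y0 mulr0 big1 // => k _.
  by rewrite (norm2_eq0 (ell2_summable y) y0) Normc.normc0 mulr0.
have a0 : 0 < norm2 x by rewrite lt_neqAle eq_sym x0 norm2_ge0.
have b0 : 0 < norm2 y by rewrite lt_neqAle eq_sym y0 norm2_ge0.
set a := norm2 x in a0 *; set b := norm2 y in b0 *.
apply: (@le_trans _ _ (b / a / 2 * series (sq_norms x) n
                       + a / b / 2 * series (sq_norms y) n)).
  rewrite /series /= !mulr_sumr -big_split /=; apply: ler_sum => k _.
  rewrite /sq_norms; set p := Normc.normc _; set q := Normc.normc _.
  rewrite -subr_ge0 (_ : _ - _ = (b * p - a * q) ^+ 2 / (a * b) / 2); last first.
    by field; rewrite !gt_eqF.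
  by rewrite !divr_ge0 ?sqr_ge0 // mulr_ge0 // ltW.
have -> : a * b = b / a / 2 * a ^+ 2 + a / b / 2 * b ^+ 2.
  by field; rewrite !gt_eqF.
by apply: lerD; apply: ler_wpM2l;
  rewrite ?series_le_norm2 ?divr_ge0 ?(ltW a0) ?(ltW b0) //;
  exact: ell2_summable.
Qed.

Lemma is_cvg_dot x y :
  cvgn (series (fun n => x n * conjc (y n)) : nat -> R[i]^o).
Proof.
apply: (@is_cvg_series_complex _ (norm2 x * norm2 y)) => n.
under eq_bigr do rewrite Normc.normcM normcJ.
exact: sum_CauchySchwarz.
Qed.

Lemma dot_CauchySchwarz x y : Normc.normc (dot x y) <= norm2 x * norm2 y.
Proof.
apply/ler_addgt0Pr => e e0.
have /cvgrPdist_lt/(_ (e%:C)) := @is_cvg_dot x y.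
rewrite ltcR => /(_ e0) [n _ /(_ n (leqnn n))] /=.
set s := series _ n; rewrite normc_normE ltcR => se.
rewrite -[dot x y](subrK s) (le_trans (le_normcD _ _)) // addrC lerD //.
  rewrite -lecR -normc_normE (le_trans (ler_norm_sum _ _ _)) //.
  under eq_bigr do rewrite normc_normE Normc.normcM normcJ.
  by rewrite -rmorph_sum lecR; exact: sum_CauchySchwarz.
exact: ltW.
Qed.

Lemma dotDZl (a : R[i]) x y z : dot (a *: x + y) z = a * dot x z + dot y z.
Proof.
pose u : nat -> R[i]^o := a *: (series (fun n => x n * conjc (z n))
    : nat -> R[i]^o) + (series (fun n => y n * conjc (z n)) : nat -> R[i]^o).
have -> : a * dot x z + dot y z = limn u.
  rewrite limD; [|by apply: is_cvgZr; exact: is_cvg_dot|exact: is_cvg_dot].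
  by rewrite limZr //; exact: is_cvg_dot.
rewrite /dot.
suff -> : (series (fun n => (a *: x + y) n * conjc (z n)) : nat -> R[i]^o) = u by [].
apply/funext => n; rewrite /u.
rewrite /series /= [RHS](_ : _ = a * (\sum_(0 <= k < n) x k * conjc (z k))
  + \sum_(0 <= k < n) y k * conjc (z k)) //.
rewrite mulr_sumr -big_split /=; apply: eq_bigr => k _.
by rewrite mulrA -mulrDl.
Qed.

End inner_product.

Section operators.
Variable R : realType.
Implicit Types (x y : ell2 R) (T : ell2 R -> ell2 R).

Definition nonneg_vec x : Prop := forall n, 0 <= x n.

Definition positive_op T : Prop := forall x, nonneg_vec x -> nonneg_vec (T x).

Definition opnorm T : \bar R :=
  ereal_sup [set (norm2 (T x))%:E | x in [set x : ell2 R | norm2 x <= 1]].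

(* [T^*y] is the vector [z] such that [<Tx, y> = <x, z>] for all [x]; it exists
   as soon as [T] is linear and bounded, see [dot_adjoint]. *)
Definition adjoint T y : ell2 R :=
  xget 0 [set z | forall x, dot (T x) y = dot x z].

Lemma norm2_ell2Z (a : R[i]) x : norm2 (a *: x) = Normc.normc a * norm2 x.
Proof. by apply: norm2Z; exact: ell2_summable. Qed.

Lemma norm2_ell2_eq0 x : norm2 x = 0 -> x = 0.
Proof.
move=> x0; apply: val_inj; apply: (norm2_eq0 _ x0).
exact: ell2_summable.
Qed.

Lemma opnorm_le1 (T : {linear ell2 R -> ell2 R}) :
  (opnorm T <= 1)%E -> forall x, norm2 (T x) <= norm2 x.
Proof.
move=> T1 x; have [x0|x0] := eqVneq (norm2 x) 0.
  have h : T x = 0 by rewrite (norm2_ell2_eq0 x0) linear0.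
  by rewrite h x0 -[0 : ell2 R](scale0r 0) norm2_ell2Z Normc.normc0 mul0r.
have x1 : 0 < norm2 x by rewrite lt_neqAle eq_sym x0 norm2_ge0.
pose a : R[i] := ((norm2 x)^-1)%:C.
have na : Normc.normc a = (norm2 x)^-1.
  by rewrite /= expr0n /= addr0 sqrtr_sqr ger0_norm // invr_ge0 ltW.
have : ((norm2 (T (a *: x)))%:E <= 1)%E.
  apply: le_trans T1; apply: ereal_sup_ubound; exists (a *: x) => //=.
  by rewrite norm2_ell2Z na mulVf.
by rewrite lee_fin linearZ norm2_ell2Z na ler_pdivrMl // mulr1.
Qed.

Definition truncation (f : nat -> R[i]) (n : nat) : nat -> R[i] :=
  fun k => if (k < n)%N then f k else 0.

Lemma series_truncation f n m :
  series (sq_norms (truncation f n)) m <= series (sq_norms f) n.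
Proof.
have e j : (j <= n)%N ->
    series (sq_norms (truncation f n)) j = series (sq_norms f) j.
  move=> jn; rewrite /series /=; apply: eq_big_nat => k /andP[_ kj].
  by rewrite /sq_norms /truncation (leq_trans kj jn).
have [mn|nm] := leqP m n.
  by rewrite e //; exact: nondecreasing_sq_norms.
rewrite -(e _ (leqnn n)) /series /= (big_cat_nat (n := n)) //=; last exact: ltnW.
rewrite [X in _ + X]big_nat_cond [X in _ + X]big1 ?addr0 // => k /andP[/andP[nk _] _].
by rewrite /sq_norms /truncation ltnNge nk /= expr0n /= addr0 sqrtr0 expr0n.
Qed.

Fact truncation_summable f n : truncation f n \in @square_summableb R.
Proof.
by apply/asboolP; exact: square_summable_bounded (series_truncation f n).
Qed.

Definition trunc f n : ell2 R := Ell2 (truncation_summable f n).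

Definition ell2_basis n : ell2 R := trunc (fun k => (k == n)%:R) n.+1.

Lemma truncS f n : trunc f n.+1 = f n *: ell2_basis n + trunc f n.
Proof.
apply: val_inj; apply/funext => k /=.
rewrite [RHS](_ : _ = f n * truncation (fun k => (k == n)%:R) n.+1 k
                      + truncation f n k) //.
rewrite /truncation ltnS leq_eqVlt.
have [->|kn] /= := eqVneq k n; first by rewrite ltnn mulr1 addr0.
by case: ifP => _; rewrite mulr0 add0r.
Qed.

Lemma trunc0 f : trunc f 0 = 0.
Proof. by apply: val_inj; apply/funext. Qed.

Lemma dot0l y : dot 0 y = 0.
Proof.
have /eqP := dotDZl 1 0 0 y.
by rewrite scaler0 addr0 mul1r -[X in X == _]addr0 (inj_eq (addrI _)) => /eqP.
Qed.

Section adjoint_exists.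
Variables (T : {linear ell2 R -> ell2 R}) (M : R).
Hypothesis M0 : 0 <= M.
Hypothesis TM : forall x, norm2 (T x) <= M * norm2 x.
Variable y : ell2 R.

Let z k : R[i] := conjc (dot (T (ell2_basis k)) y).

Let dot_trunc f n : dot (T (trunc f n)) y = \sum_(0 <= k < n) f k * conjc (z k).
Proof.
elim: n => [|n IHn]; first by rewrite trunc0 linear0 dot0l big_nil.
rewrite truncS linearD linearZ /= dotDZl IHn big_nat_recr //= addrC.
by rewrite /z conjcK.
Qed.

Let z_bound n : series (sq_norms z) n <= (M * norm2 y) ^+ 2.
Proof.
set S := series (sq_norms z) n.
have S0 : 0 <= S := series_sq_norms_ge0 z n.
have zS : norm2 (trunc z n) <= Num.sqrt S.
  apply: norm2_le => [|m]; first exact: sqrtr_ge0.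
  by rewrite sqr_sqrtr //; exact: series_truncation.
have h : dot (T (trunc z n)) y = S%:C.
  rewrite dot_trunc /S /series /= rmorph_sum; apply: eq_bigr => k _.
  by rewrite /sq_norms -sqr_normc normc_normE rmorphXn.
have : S <= M * Num.sqrt S * norm2 y.
  have := dot_CauchySchwarz (T (trunc z n)) y.
  rewrite h /= expr0n /= addr0 sqrtr_sqr ger0_norm // => /le_trans; apply.
  apply: ler_wpM2r; first exact: norm2_ge0.
  by apply: (le_trans (TM _)); exact: ler_wpM2l.
move: (sqr_sqrtr S0) (sqrtr_ge0 S) (norm2_ge0 y).
move: (Num.sqrt S) (norm2 y) => s b <-.
rewrite le_eqVlt => /orP[/eqP <- _ _|s0 b0].
  by rewrite expr0n /= sqr_ge0.
rewrite -mulrA mulrCA expr2 ler_pM2l // => sb.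
by rewrite ler_sqr // nnegrE ?mulr_ge0 // ltW.
Qed.

Let zP : z \in @square_summableb R.
Proof. by apply/asboolP; exact: square_summable_bounded z_bound. Qed.

Lemma norm2_tail x n :
  norm2 (x - trunc x n) <=
    Num.sqrt (limn (series (sq_norms x)) - series (sq_norms x) n).
Proof.
have xs : square_summable x := @ell2_summable R x.
have sL m : series (sq_norms x) m <= limn (series (sq_norms x)).
  by apply: nondecreasing_cvgn_le xs m; exact: nondecreasing_sq_norms.
apply: norm2_le => [|m]; first exact: sqrtr_ge0.
rewrite sqr_sqrtr ?subr_ge0 // lerBrDr.
have e k : sq_norms (x - trunc x n) k = if (k < n)%N then 0 else sq_norms x k.
  rewrite /sq_norms [((x - trunc x n) : ell2 R) k](_ : _ =
    x k - truncation x n k) // /truncation.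
  by case: ifP => _; rewrite ?subrr ?subr0 // Normc.normc0 expr0n.
have [mn|nm] := leqP m n.
  rewrite {1}/series /= big_nat_cond big1 ?add0r // => k /andP[/andP[_ km] _].
  by rewrite e (leq_trans km mn).
apply: le_trans (sL m); rewrite /series /=.
rewrite (big_cat_nat (n := n) (p := m)) ?(ltnW nm) //=.
rewrite big_nat_cond big1 ?add0r; last first.
  by move=> k /andP[/andP[_ kn] _]; rewrite e kn.
rewrite [leRHS](big_cat_nat (n := n) (p := m)) ?(ltnW nm) //=.
rewrite [leRHS]addrC lerD2r; apply: ler_sum_nat => k /andP[nk _].
by rewrite e ltnNge nk.
Qed.

Lemma cvg_dot_trunc x :
  ((fun n => dot (T (trunc x n)) y) : nat -> R[i]^o) @ \oo
    --> (dot (T x) y : R[i]^o).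
Proof.
apply/cvgrPdist_lt => e e0.
have [r er] : exists r : R, e = r%:C by apply/complex_realP; exact: gtr0_real.
have r0 : 0 < r by rewrite -ltcR -er.
have xs : square_summable x := @ell2_summable R x.
pose K := M * norm2 y + 1.
have K0 : 0 < K by rewrite ltr_wpDl // mulr_ge0 // norm2_ge0.
have d0 : 0 < (r / K) ^+ 2 by rewrite exprn_gt0 // divr_gt0.
move/cvgrPdist_lt : (xs) => /(_ _ d0); apply: filterS => n.
set d := _ - _ => dr.
have nx : norm2 (x - trunc x n) < r / K.
  apply: (le_lt_trans (norm2_tail x n)).
  rewrite -[ltRHS]ger0_norm ?divr_ge0 ?(ltW r0) ?(ltW K0) // -sqrtr_sqr.
  by rewrite ltr_sqrt // (le_lt_trans (ler_norm _)).
have -> : dot (T x) y - dot (T (trunc x n)) y = dot (T (x - trunc x n)) y.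
  rewrite linearB addrC -mulN1r -dotDZl scaleN1r; congr dot.
  exact: addrC.
rewrite er normc_normE ltcR (le_lt_trans (dot_CauchySchwarz _ _)) //.
apply: (@le_lt_trans _ _ (M * norm2 (x - trunc x n) * norm2 y)).
  by apply: ler_wpM2r; [exact: norm2_ge0|exact: TM].
have := norm2_ge0 (x - trunc x n); have := norm2_ge0 y.
move: nx; rewrite ltr_pdivlMr // /K.
move: (norm2 _) (norm2 y) => a b; nra.
Qed.

Lemma dot_adjoint x : dot (T x) y = dot x (adjoint T y).
Proof.
rewrite /adjoint; case: xgetP => [_ _ -> //|/(_ (Ell2 zP)) []] x'.
apply: (cvg_unique _ (@cvg_dot_trunc x')) => //.
rewrite (_ : (fun n => dot (T (trunc x' n)) y) =
             series (fun n => x' n * conjc (z n))); last first.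
  by apply/funext => n; rewrite dot_trunc.
exact: (@is_cvg_dot _ x' (Ell2 zP)).
Qed.

End adjoint_exists.

End operators.

(* The set $\mathcal{P}_1(\ell_2)$; boundedness is part of [opnorm T <= 1], the
   operator norm being extended-real valued. *)
Record pos_contraction (R : realType) := PosContraction {
  pos_contraction_linear :> {linear ell2 R -> ell2 R};
  pos_contraction_pos : positive_op pos_contraction_linear;
  pos_contraction_opnorm : (opnorm pos_contraction_linear <= 1)%E }.

HB.instance Definition _ (R : realType) :=
  gen_eqMixin (pos_contraction R).
HB.instance Definition _ (R : realType) :=
  gen_choiceMixin (pos_contraction R).

Lemma pos_contraction_ext (R : realType) (S T : pos_contraction R) :
  S =1 T -> S = T.
Proof.
case: S T => [[S [[Sa] [Sl]]] Sp S1] [[T [[Ta] [Tl]]] Tp T1] /= /funext ST.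
subst T.
by rewrite (Prop_irrelevance Ta Sa) (Prop_irrelevance Tl Sl) in Tp T1 *;
  rewrite (Prop_irrelevance Tp Sp) (Prop_irrelevance T1 S1).
Qed.

Lemma dot_adjoint_pos_contraction (R : realType) (T : pos_contraction R)
    (x y : ell2 R) : dot (T x) y = dot x (adjoint T y).
Proof.
apply: (@dot_adjoint _ _ 1) => // z; rewrite mul1r.
by apply: opnorm_le1; exact: pos_contraction_opnorm.
Qed.

(* [{ptws U -> V}] carries the product topology, so that the initial topologies
   below are the coarsest ones making [T |-> <y, Tx>], respectively [T |-> Tx]
   and [T |-> T^*x], continuous for all vectors [x] and [y]. *)
Definition matrix_coefficients (R : realType) (T : pos_contraction R) :
  {ptws (ell2 R * ell2 R)%type -> R[i]^o} := fun p => dot p.2 (T p.1).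

Definition WOT (R : realType) : topologicalType :=
  initial_topology (@matrix_coefficients R).

Definition orbit_maps (R : realType) (T : pos_contraction R) :
  {ptws ell2 R -> (ell2 R * ell2 R)%type} := fun x => (T x, adjoint T x).

Definition SOTstar (R : realType) : topologicalType :=
  initial_topology (@orbit_maps R).

(* Separable and completely metrizable; a topologicalType need not be pointed,
   hence no [cvg F], which is defined through a choice of limit. *)
Definition polish (R : realType) (X : topologicalType) : Prop :=
  (exists2 D : set X, countable D & dense D) /\
  (exists m : Metric R X, let M : metricType R := Metric.Pack m in
     (@open M = @open X) /\
     (forall F : set_system M, ProperFilter F -> cauchy F ->
        exists x : M, F --> x)).

Definition comeager (X : topologicalType) (A : set X) : Prop :=
  exists2 G : set X, Gdelta G /\ dense G & G `<=` A.

Definition invariant_subspace (R : realType) (T : ell2 R -> ell2 R)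
    (V : set (ell2 R)) : Prop :=
  [/\ closed V, V 0,
      forall (a : R[i]) (u v : ell2 R), V u -> V v -> V (a *: u + v) &
      T @` V `<=` V].

Definition has_nontrivial_invariant_subspace (R : realType)
    (T : ell2 R -> ell2 R) : Prop :=
  exists V : set (ell2 R),
    [/\ invariant_subspace T V, V <> [set 0] & V <> setT].

(* Main.v *)
Require Import Defs.
From HB Require Import structures.
From mathcomp Require Import all_boot all_order all_algebra.
From mathcomp Require Import all_classical all_reals all_analysis.
From mathcomp Require Import complex.
From mathcomp Require Import ring lra.

Set Implicit Arguments.
Unset Strict Implicit.
Unset Printing Implicit Defensive.

Import Order.TTheory GRing.Theory Num.Theory.
Import numFieldNormedType.Exports.
Import ComplexField.

Local Open Scope classical_set_scope.
Local Open Scope ring_scope.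

(** Call [<z, w> - <T z, T w>] the defect of [z] and [w]; for a contraction it
    is a positive semidefinite form [d]. If [d (T^n x) w = 0] for all [n >= 1]
    while [d x w] is non-zero, then the vectors [z] with [d (T^n z) w = 0] for
    all [n >= 0] form a closed invariant subspace, which contains [T x] and
    does not contain [x] ([has_invariant_of_defect]; if [T x = 0], the kernel
    of [T] or, for [T = 0], a hyperplane serves). It remains to find such a
    pair [x, w] for a typical [T].

    The gain over asking for [<T^n x, y> = 0] with an arbitrary [y] is that the
    defects along an orbit are square summable: by Cauchy-Schwarz and
    telescoping, the sum of [|d (T^n x) w|^2] over [n >= N] is at most [|T^N
    x|^2 |w|^2] ([sum_defect_le]). Hence the smallness of all the defects is
    implied by a condition on finitely many powers of [T], the smallness of the
    [residual], which is open for the strong-star topology.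

    If the residual of [x, w] is less than [eta^4], then for a dense set of
    operators nearby it can be made as small as desired by moving [x] and [w]
    by at most [eta] ([extension_step]). Replace [T] by a finite strict
    compression on the first [m] coordinates, whose powers tend to zero,
    together with the backward shift on the other ones. Adding [eta e_m] to
    [w], and to [x] a vector [u] of the shifted part, changes the [n]-th defect
    by [eta u_(m+n)]; this cancels any prescribed square summable sequence, and
    [|u| <= eta] because the sum of the squared defects is at most [eta^4]. The
    Baire category theorem, applied to countably many rational data, gives for
    a typical [T] an infinite chain of such corrections ([comeager_chain]); its
    limit is the required pair ([limit_invariant]).

    Finally, the topology [tau] is only known to lie between the weak and the
    strong-star ones. By [WOT_open_in_sotball], every strong-star ball contains
    a non-empty weakly open set, so that passing to interiors for [tau] loses
    nothing. Here positivity enters: near any operator there is one, [T], that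
    attains its norm at a positive vector [U] whose first coordinates are at
    least [1], and whose adjoint does so at [T U]. A positive contraction [S]
    weakly close to [T] has [S U] close to [T U] in norm, and as [S U]
    dominates the vectors [S e_i], these are close in norm to the [T e_i]
    ([norm_attaining_close]). *)

(** * Baire category and chains of open conditions *)

Section Baire_category.
Variable R : realType.

(** The usual argument by shrinking balls; completeness is stated as for
    [polish], for a metric space that need not have a default point. *)
Lemma Baire_metric (M : metricType R)
    (complete : forall F : set_system M, ProperFilter F -> cauchy F ->
       exists x : M, F --> x)
    (U : nat -> set M) :
  (forall n, open (U n) /\ dense (U n)) -> dense (\bigcap_n U n).
Proof.
move=> oU O [a Oa] oO.
(* The limit of the centres is only known to lie in the doubled balls. *)
have step (n : nat) (p : {p : M * R | 0 < p.2}) : exists q : {p : M * R | 0 < p.2},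
    [/\ ball (sval q).1 (2 * (sval q).2) `<=` ball (sval p).1 (sval p).2 `&` U n
      & (sval q).2 <= (sval p).2 / 2].
  case: p => -[x r] /= r0.
  have [oUn dUn] := oU n.
  have [y [By Uy]] : ((ball x r)^° `&` U n) !=set0.
    apply: dUn; last exact: open_interior.
    by exists x; exact: nbhsx_ballx.
  have : nbhs y ((ball x r)^° `&` U n).
    by apply: open_nbhs_nbhs; split => //; apply: openI => //; exact: open_interior.
  move=> /nbhs_ballP[e /= e0 ye].
  have q0 : 0 < Num.min (e / 2) (r / 2) by rewrite lt_min !divr_gt0.
  exists (exist _ (y, Num.min (e / 2) (r / 2)) q0) => /=.
  split; last by rewrite ge_min lexx orbT.
  move=> z yz; have /ye[Bz Uz] : ball y e z.
    apply: le_ball yz; rewrite mulrC -ler_pdivlMr //.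
    by rewrite ge_min lexx.
  by split => //; exact: interior_subset Bz.
have : nbhs a O by exact: open_nbhs_nbhs.
move=> /nbhs_ballP[e /= e0 ae].
have [f fP] := choice (fun np => step np.1 np.2).
pose s := fix s n := if n is m.+1 then f (m, s m)
                     else exist (fun p : M * R => 0 < p.2) (a, e) e0.
pose x n := (sval (s n)).1; pose r n := (sval (s n)).2.
have r0 n : 0 < r n by exact: (svalP (s n)).
have sub n : ball (x n.+1) (2 * r n.+1) `<=` ball (x n) (r n) `&` U n.
  by have [] := fP (n, s n).
have half n : r n.+1 <= r n / 2 by have [] := fP (n, s n).
have inc n m : (n <= m)%N -> ball (x m) (r m) `<=` ball (x n) (r n).
  move=> /subnKC <-; elim: (m - n)%N => [|k IHk]; first by rewrite addn0.
  rewrite addnS => y xy; apply: IHk.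
  have [|//] := sub (n + k)%N y.
  by apply: le_ball xy; have := r0 (n + k).+1; lra.
have r_small n : r n <= e / 2 ^+ n.
  elim: n => [|n IHn]; first by rewrite expr0 divr1.
  apply: le_trans (half n) _; rewrite exprS invfM mulrA mulrAC.
  by rewrite ler_pdivlMr // mulfVK // .
have cx : cauchy (x @ \oo).
  apply/cauchy_ballP => d d0.
  have [n nd] : exists n : nat, e / 2 ^+ n < d / 2.
    have : (fun n : nat => e / 2 ^+ n) @ \oo --> (0 : R).
      rewrite -(mulr0 e); apply: cvgMr; rewrite [X in X @ _](_ : _ = fun n => (1/2) ^+ n); last first.
        by apply/funext => n; rewrite exprMn expr1n mul1r exprVn.
      by apply: cvg_expr; rewrite ger0_norm; lra.
    move/cvgrPdist_lt => /(_ (d / 2)); rewrite divr_gt0 // => /(_ isT).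
    move=> [n _ /(_ n (leqnn n))] /=; rewrite sub0r normrN => h.
    by exists n; apply: le_lt_trans h; exact: ler_norm.
  exists ((x @` [set k | (n <= k)%N]), (x @` [set k | (n <= k)%N])).
    by split; exists n => // k /= nk; exists k.
  move=> [y z] /= [[k nk <-] [l nl <-]].
  have rn : r n <= d / 2 by apply: le_trans (r_small n) _; exact: ltW.
  have h k' : (n <= k')%N -> ball (x n) (d / 2) (x k').
    move=> nk'; apply: (le_ball rn); apply: (inc _ _ nk').
    exact: ballxx.
  rewrite [d]splitr; apply: ball_triangle (h l nl).
  by apply: ball_sym; exact: h.
have [l xl] := complete _ _ cx.
have lB n : ball (x n) (2 * r n) l.
  have : (x @ \oo) (ball l (r n)) by apply: xl; exact: nbhsx_ballx.
  move=> [k _ /(_ (maxn k n))] /=; rewrite leq_maxl => /(_ isT) h.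
  rewrite mulrDl mul1r; apply: ball_triangle (ball_sym h).
  by apply: (inc n (maxn k n) (leq_maxr _ _)); exact: ballxx.
exists l; split.
  by apply: ae; have [] := sub 0%N l (lB 1%N).
by move=> n _; have [] := sub n l (lB n.+1).
Qed.

Lemma polish_Baire (X : topologicalType) (U : nat -> set X) : polish R X ->
  (forall n, open (U n) /\ dense (U n)) -> dense (\bigcap_n U n).
Proof.
move=> [_ [m [oM complete]]] oU.
have oE (A : set X) : @open (Metric.Pack m) A = open A by rewrite oM.
have := @Baire_metric (Metric.Pack m) complete U.
have h : forall n, @open (Metric.Pack m) (U n) /\
    @dense (Metric.Pack m) (U n).
  move=> n; have [oUn dUn] := oU n; split; first by rewrite oE.
  by move=> A A0; rewrite oE => oA; exact: dUn.
move=> /(_ h) D A A0 oA; apply: D => //.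
by rewrite oE.
Qed.

(** For each index [i] the points that leave the closure of [G i] or enter some
    successor of [G i] form a dense open set, and in the intersection of these
    sets a chain can be continued forever. *)
Lemma comeager_chain (X : topologicalType) (I : countType) (G : I -> set X)
    (init : set I) (succ : I -> I -> Prop) : polish R X ->
  (forall i, open (G i)) ->
  (forall V, open V -> V !=set0 ->
     exists2 i, init i & (V `&` G i) !=set0) ->
  (forall i V, open V -> V !=set0 -> V `<=` G i ->
     exists2 j, succ i j & (V `&` G j) !=set0) ->
  comeager [set x : X | exists c : nat -> I,
    [/\ init (c 0%N), forall k, succ (c k) (c k.+1) & forall k, G (c k) x]].
Proof.
move=> XR oG start extend.
pose next i := (~` G i)^° `|` \bigcup_(j in [set j | succ i j]) G j.
pose U n := match n with
  | 0 => \bigcup_(i in init) G i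
  | n.+1 => if unpickle n is Some i then next i else setT end.
have oU n : open (U n) /\ dense (U n).
  case: n => [|n] /=.
    split; first by apply: bigcup_open => i _; exact: oG.
    by move=> V V0 oV; have [i ii [x [Vx Gx]]] := start V oV V0; exists x; split=> //; exists i.
  case: unpickle => [i|]; last first.
    by split; [exact: openT|move=> V V0 oV; rewrite setIT].
  split.
    apply: openU; first exact: open_interior.
    by apply: bigcup_open => j _; exact: oG.
  move=> V V0 oV; have [VG0|] := pselect ((V `&` G i) !=set0).
    have [|j sij [x [[Vx Gix] Gjx]]] := extend i _ (openI oV (oG i)) VG0.
      by apply: subIsetr.
    by exists x; split => //; right; exists j.
  move=> VG0; have [x Vx] := V0; exists x; split => //; left.
  rewrite /interior nbhsE; exists V; first by split.
  by move=> y Vy Gy; apply: VG0; exists y.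
exists (\bigcap_n U n).
  split; last exact: polish_Baire XR oU.
  by exists U => // n; have [] := oU n.
move=> x Ux.
have [i0 i0init Gi0] := Ux 0%N Logic.I.
have st (p : {i | G i x}) : exists q : {i | G i x}, succ (sval p) (sval q).
  case: p => i Gi /=; have := Ux (pickle i).+1 Logic.I; rewrite /= pickleK => -[|[j sij Gj]].
    by move=> /interior_subset.
  by exists (exist _ j Gj).
have [f fP] := choice st.
pose s := fix s n := if n is m.+1 then f (s m)
  else exist (fun i => G i x) i0 Gi0.
exists (fun n => sval (s n)); split=> [//|k|k].
  exact: (fP (s k)).
exact: (svalP (s k)).
Qed.

End Baire_category.

(** * The Hilbert space of square summable sequences *)

Section ell2_theory.
Variable R : realType.
Implicit Types (x y z : ell2 R) (a : R[i]).

Local Notation normc := (@Normc.normc R).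

Lemma ell2_ext x y : (forall n, x n = y n) -> x = y.
Proof. by move=> xy; apply: val_inj; apply/funext. Qed.

Lemma ell2D x y n : (x + y) n = x n + y n. Proof. by []. Qed.
Lemma ell2N x n : (- x) n = - x n. Proof. by []. Qed.
Lemma ell2B x y n : (x - y) n = x n - y n. Proof. by []. Qed.
Lemma ell2Z a x n : (a *: x) n = a * x n. Proof. by []. Qed.
Lemma ell20 n : (0 : ell2 R) n = 0. Proof. by []. Qed.

Lemma truncE (f : nat -> R[i]) m k : trunc f m k = if (k < m)%N then f k else 0.
Proof. by []. Qed.

Lemma normcN a : normc (- a) = normc a.
Proof. by case: a => b c /=; rewrite !sqrrN. Qed.

Lemma normcB a b : normc (a - b) = normc (b - a).
Proof. by rewrite -normcN opprB. Qed.

Lemma normc_real (r : R) : 0 <= r -> normc r%:C%C = r.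
Proof. by move=> r0; rewrite /= expr0n /= addr0 sqrtr_sqr ger0_norm. Qed.

Lemma normc_sq_real (r : R) : normc r%:C%C ^+ 2 = r ^+ 2.
Proof. by rewrite /= expr0n /= addr0 sqrtr_sqr real_normK // num_real. Qed.

Lemma ler_normcB a b : `|normc a - normc b| <= normc (a - b).
Proof.
rewrite ler_norml; apply/andP; split.
  rewrite lerBrDr addrC lerBlDr (normcB a b).
  by have := le_normcD a (b - a); rewrite subrKC.
by rewrite lerBlDr; have := le_normcD (a - b) b; rewrite subrK.
Qed.

Lemma norm2_0 : norm2 (0 : ell2 R) = 0.
Proof. by rewrite -[0 : ell2 R](scale0r 0) norm2_ell2Z Normc.normc0 mul0r. Qed.

Lemma norm2N x : norm2 (- x) = norm2 x.
Proof. by rewrite -scaleN1r norm2_ell2Z normcN Normc.normc1 mul1r. Qed.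

Lemma norm2B x y : norm2 (x - y) = norm2 (y - x).
Proof. by rewrite -norm2N opprB. Qed.

Lemma norm2D_le x y : norm2 (x + y) <= norm2 x + norm2 y.
Proof. by apply: ler_norm2D; exact: ell2_summable. Qed.

Lemma norm2B_le x y : norm2 (x - y) <= norm2 x + norm2 y.
Proof. by rewrite -(norm2N y); exact: norm2D_le. Qed.

Lemma norm2_triangle y x z : norm2 (x - z) <= norm2 (x - y) + norm2 (y - z).
Proof. by have := norm2D_le (x - y) (y - z); rewrite addrA subrK. Qed.

Lemma ler_norm2B x y : `|norm2 x - norm2 y| <= norm2 (x - y).
Proof.
rewrite ler_norml lerBrDr addrC lerBlDr andbC; apply/andP; split.
  by rewrite lerBlDr; have := norm2D_le (x - y) y; rewrite subrK.
by have := norm2D_le (y - x) x; rewrite subrK norm2B addrC.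
Qed.

Lemma norm2_series x :
  series (sq_norms x) n @[n --> \oo] --> norm2 x ^+ 2.
Proof.
rewrite sqr_sqrtr; last first.
  apply: limr_ge; first exact: (@ell2_summable R x).
  by apply: nearW => n; exact: series_sq_norms_ge0.
exact: (@ell2_summable R x).
Qed.

Lemma dot_series x y :
  ((fun n => \sum_(0 <= k < n) x k * conjc (y k)) : nat -> R[i]^o) @ \oo
    --> (dot x y : R[i]^o).
Proof. exact: is_cvg_dot. Qed.

Lemma cvg_uniqueC (u : nat -> R[i]^o) (a b : R[i]^o) :
  u @ \oo --> a -> u @ \oo --> b -> a = b :> R[i].
Proof. by move=> ua ub; exact: (cvg_unique _ ua ub). Qed.

Lemma dotxx x : dot x x = (norm2 x ^+ 2)%:C%C.
Proof.
apply: (cvg_uniqueC (@dot_series x x)).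
rewrite [X in X @ _](_ : _ = fun n => (series (sq_norms x) n)%:C%C).
  exact: cvg_real_complex (@norm2_series x).
apply/funext => n; rewrite /series /= rmorph_sum; apply: eq_bigr => k _.
by rewrite /sq_norms rmorphXn /= -normc_normE sqr_normc.
Qed.

Lemma dotC x y : dot y x = conjc (dot x y).
Proof.
apply: (cvg_uniqueC (@dot_series y x)).
apply/cvgrPdist_lt => e e0.
have := @dot_series x y; move/cvgrPdist_lt => /(_ e e0); apply: filterS => n.
rewrite (_ : conjc (dot x y) - _ =
  conjc (dot x y - \sum_(0 <= k < n) x k * conjc (y k))).
  by rewrite !normc_normE Defs.normcJ.
rewrite rmorphB /= rmorph_sum /=; congr (_ - _).
by apply: eq_bigr => k _; rewrite rmorphM /= conjcK mulrC.
Qed.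

Lemma dotDl x y z : dot (x + y) z = dot x z + dot y z.
Proof. by have := dotDZl 1 x y z; rewrite scale1r mul1r. Qed.

Lemma dotZl a x z : dot (a *: x) z = a * dot x z.
Proof. by have := dotDZl a x 0 z; rewrite dot0l !addr0. Qed.

Lemma dotNl x z : dot (- x) z = - dot x z.
Proof. by rewrite -scaleN1r dotZl mulN1r. Qed.

Lemma dotBl x y z : dot (x - y) z = dot x z - dot y z.
Proof. by rewrite dotDl dotNl. Qed.

Lemma dotDr x y z : dot z (x + y) = dot z x + dot z y.
Proof. by rewrite dotC dotDl rmorphD /= -!dotC. Qed.

Lemma dotZr a x z : dot z (a *: x) = conjc a * dot z x.
Proof. by rewrite dotC dotZl rmorphM /= -dotC. Qed.

Lemma dotNr x z : dot z (- x) = - dot z x.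
Proof. by rewrite dotC dotNl rmorphN /= -dotC. Qed.

Lemma dotBr x y z : dot z (x - y) = dot z x - dot z y.
Proof. by rewrite dotDr dotNr. Qed.

Lemma dot0r z : dot z 0 = 0.
Proof. by rewrite dotC dot0l conjc0. Qed.

Lemma dot_truncr x f m :
  dot x (trunc f m) = \sum_(0 <= k < m) x k * conjc (f k).
Proof.
apply: (cvg_uniqueC (@dot_series x (trunc f m))).
apply: cvg_near_cst; exists m => // n /= mn.
rewrite (big_cat_nat (n := m)) //= [X in _ + X]big_nat_cond.
rewrite [X in _ + X]big1 ?addr0; last first.
  by move=> k /andP[/andP[mk _] _]; rewrite /truncation ltnNge mk [conjc _](conjc0 R) mulr0.
rewrite big_nat_cond [RHS]big_nat_cond; apply: eq_bigr => k /andP[/andP[_ km] _].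
by rewrite /truncation km.
Qed.

Lemma basisE n k : ell2_basis R n k = (k == n)%:R.
Proof.
rewrite /= /truncation ltnS; case: ifPn => //.
by rewrite -ltnNge => /gtn_eqF ->.
Qed.

Lemma dot_basisr x n : dot x (ell2_basis R n) = x n.
Proof.
rewrite /ell2_basis dot_truncr big_nat_recr //= big_nat_cond big1 ?add0r; last first.
  by move=> k /andP[/andP[_ /ltn_eqF ->] _]; rewrite conjc0 mulr0.
by rewrite eqxx conjc1 mulr1.
Qed.

Lemma dot_basisl x n : dot (ell2_basis R n) x = conjc (x n).
Proof. by rewrite dotC dot_basisr. Qed.

Lemma norm2_truncE f m :
  norm2 (trunc f m) ^+ 2 = \sum_(0 <= k < m) normc (f k) ^+ 2.
Proof.
apply/complexI; rewrite -dotxx dot_truncr rmorph_sum /= big_nat_cond.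
rewrite [RHS]big_nat_cond; apply: eq_bigr => k /andP[/andP[_ km] _].
by rewrite /truncation km rmorphXn /= -normc_normE sqr_normc.
Qed.

Lemma norm2_basis n : norm2 (ell2_basis R n) = 1.
Proof.
have : norm2 (ell2_basis R n) ^+ 2 = 1.
  by apply: complexI; rewrite -dotxx dot_basisr basisE eqxx.
by move/eqP; rewrite sqrp_eq1 ?norm2_ge0 // => /eqP.
Qed.

Lemma normc_coord x n : normc (x n) <= norm2 x.
Proof.
have := dot_CauchySchwarz x (ell2_basis R n).
by rewrite dot_basisr norm2_basis mulr1.
Qed.

Lemma norm2_dominated x y : (forall n, normc (x n) <= normc (y n)) ->
  norm2 x <= norm2 y.
Proof.
move=> xy; apply: norm2_le => [|n]; first exact: norm2_ge0.
apply: le_trans (series_le_norm2 n (@ell2_summable R y)).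
apply: ler_sum => k _; rewrite /sq_norms ler_sqr ?nnegrE ?normc_ge0 //.
Qed.

Lemma truncD x y m : trunc (x + y : ell2 R) m = trunc x m + trunc y m.
Proof.
by apply: ell2_ext => k; rewrite ell2D !truncE; case: ifP; rewrite ?addr0.
Qed.

Lemma truncZ a x m : trunc (a *: x : ell2 R) m = a *: trunc x m.
Proof.
by apply: ell2_ext => k; rewrite ell2Z !truncE; case: ifP; rewrite ?mulr0.
Qed.

Lemma trunc_le x m : norm2 (trunc x m) <= norm2 x.
Proof.
apply: norm2_dominated => n; rewrite truncE; case: ifP => // _.
by rewrite Normc.normc0 normc_ge0.
Qed.

Lemma trunc_id x m k : (m <= k)%N -> trunc x m = x -> trunc x k = x.
Proof.
move=> mk xm; apply: ell2_ext => i; rewrite truncE; case: ifPn => //.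
rewrite -leqNgt => ki; rewrite -xm truncE ltnNge (leq_trans mk ki) //.
Qed.

Lemma ell2_sum (f : nat -> ell2 R) m n i :
  (\sum_(m <= j < n) f j) i = \sum_(m <= j < n) f j i.
Proof. by apply: (big_morph (fun x : ell2 R => x i)). Qed.

Lemma trunc_sum x m :
  trunc x m = \sum_(0 <= k < m) x k *: ell2_basis R k.
Proof.
elim: m => [|m IHm]; first by rewrite Defs.trunc0 big_nil.
by rewrite truncS IHm big_nat_recr //= addrC.
Qed.

Lemma norm2_trunc_le_sum (f : nat -> R[i]) M :
  norm2 (trunc f M) <= \sum_(0 <= k < M) normc (f k).
Proof.
elim: M => [|M IHM]; first by rewrite Defs.trunc0 norm2_0 big_nil.
rewrite truncS big_nat_recr // addrC; apply: (le_trans (norm2D_le _ _)).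
by apply: lerD => //; rewrite norm2_ell2Z norm2_basis mulr1.
Qed.

Lemma trunc_trunc (f : nat -> R[i]) m : trunc (trunc f m) m = trunc f m.
Proof. by apply: ell2_ext => k; rewrite !truncE; case: ifP => // ->. Qed.

Lemma trunc_basis i m : (i < m)%N -> trunc (ell2_basis R i) m = ell2_basis R i.
Proof.
move=> im; apply: ell2_ext => k; rewrite truncE basisE; case: ifPn => //.
by rewrite -leqNgt => mk; rewrite gtn_eqF // (leq_trans im).
Qed.

Lemma trunc_basis0 i m : (m <= i)%N -> trunc (ell2_basis R i) m = 0.
Proof.
move=> im; apply: ell2_ext => k; rewrite truncE basisE; case: ifPn => //.
by move=> km; rewrite ltn_eqF // (leq_trans km).
Qed.

Lemma dot_trunc_sym x y m : dot (trunc x m) y = dot x (trunc y m).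
Proof.
rewrite dotC !dot_truncr rmorph_sum; apply: eq_bigr => k _.
by rewrite rmorphM /= conjcK mulrC.
Qed.

Lemma norm2_tail_small x (e : R) : 0 < e ->
  exists m, forall k, (m <= k)%N -> norm2 (x - trunc x k) < e.
Proof.
move=> e0; have /cvgrPdist_lt := @norm2_series x.
move=> /(_ (e ^+ 2)); rewrite exprn_gt0 // => /(_ isT) [m _ h].
exists m => k mk; apply: (le_lt_trans (norm2_tail x k)).
rewrite -(ger0_norm (ltW e0)) -sqrtr_sqr ltr_sqrt ?exprn_gt0 //.
have := h k mk; rewrite sqr_sqrtr; first by move/(le_lt_trans (ler_norm _)).
apply: limr_ge; first exact: (@ell2_summable R x).
by apply: nearW => n; exact: series_sq_norms_ge0.
Qed.

Lemma norm2_split x m :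
  norm2 x ^+ 2 = norm2 (trunc x m) ^+ 2 + norm2 (x - trunc x m) ^+ 2.
Proof.
have orth : dot (trunc x m) (x - trunc x m) = 0.
  rewrite dotC dot_truncr big_nat_cond big1 ?conjc0 //.
  move=> k /andP[/andP[_ km] _]; rewrite ell2B truncE km subrr mul0r //.
have orth' : dot (x - trunc x m) (trunc x m) = 0 by rewrite dotC orth conjc0.
have real_add (a b c : R) : a%:C%C = b%:C%C + c%:C%C -> a = b + c.
  by move=> /(congr1 (@complex.Re R)).
apply: real_add; rewrite -!dotxx.
set y := trunc x m in orth orth' *; set z := x - y in orth orth' *.
have xyz : x = y + z by rewrite /z subrKC.
clearbody z y; rewrite xyz.
by rewrite dotDl !dotDr orth orth' addr0 add0r.
Qed.

(** Completeness of the space: the coordinates converge, and a bound on all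
    the finite partial sums of the distance passes to the limit. *)
Lemma geometric_cvg (x : nat -> ell2 R) (c : R) :
  (forall k, norm2 (x k.+1 - x k) <= c / 2 ^+ k) ->
  exists l : ell2 R, forall k, norm2 (l - x k) <= 2 * c / 2 ^+ k.
Proof.
move=> step.
have c0 : 0 <= c.
  by have := le_trans (norm2_ge0 _) (step 0%N); rewrite expr0 divr1.
(* The bound is a difference so that the geometric series telescopes. *)
have far k j : norm2 (x (k + j)%N - x k) <= 2 * c / 2 ^+ k - 2 * c / 2 ^+ (k + j).
  elim: j => [|j IHj]; first by rewrite addn0 !subrr norm2_0.
  apply: (le_trans (norm2_triangle (x (k + j)%N) _ _)).
  rewrite addnS; apply: (le_trans (lerD (step _) IHj)).
  rewrite exprS; set p := _ ^+ (k + j); set q := _ ^+ k.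
  have p0 : p != 0 by rewrite expf_neq0.
  have q0 : q != 0 by rewrite expf_neq0.
  by rewrite le_eqVlt; apply/orP; left; apply/eqP; field; rewrite p0.
have farle k j : norm2 (x (k + j)%N - x k) <= 2 * c / 2 ^+ k.
  by apply: (le_trans (far k j)); rewrite gerBl divr_ge0 ?mulr_ge0 // exprn_ge0.
have cv i : exists l : R[i],
    ((fun j => x j i) : nat -> R[i]^o) @ \oo --> (l : R[i]^o).
  have : cvgn (series (fun j => x j.+1 i - x j i) : nat -> R[i]^o).
    apply: (@is_cvg_series_complex _ _ (2 * c)) => n.
    apply: (@le_trans _ _ (\sum_(0 <= k < n) c / 2 ^+ k)).
      by apply: ler_sum => k _; apply: le_trans (step k); exact: (normc_coord (x k.+1 - x k) i).
    have -> : \sum_(0 <= k < n) c / 2 ^+ k = 2 * c - 2 * c / 2 ^+ n.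
      elim: n => [|n IHn]; first by rewrite big_nil expr0 divr1 subrr.
      by rewrite big_nat_recr //= IHn exprS; field; rewrite expf_neq0.
    by rewrite gerBl divr_ge0 ?mulr_ge0 // exprn_ge0.
  move=> /cvg_ex[/= l xl]; exists (x 0%N i + l).
  rewrite (_ : (fun j => x j i) = (fun j => x 0%N i + series (fun j => x j.+1 i - x j i) j)).
    apply: (@cvgD _ R[i]^o _ _ _ (fun=> x 0%N i : R[i]^o) _ _ _ _ xl).
    exact: cvg_cst.
  by apply/funext => j; rewrite /series /= telescope_sumr // subrKC.
have [l xl] := choice cv.
have bound k n : series (sq_norms (trunc (fun i => l i - x k i) n)) n <= (2 * c / 2 ^+ k) ^+ 2.
  have b0 : 0 <= 2 * c / 2 ^+ k by rewrite divr_ge0 ?mulr_ge0 // exprn_ge0.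
  pose t := trunc (fun i => l i - x k i) n.
  apply: (le_trans (series_le_norm2 n (@ell2_summable R t))).
  rewrite ler_sqr ?nnegrE ?norm2_ge0 //.
  apply/ler_addgt0Pr => e e0.
  have near i : \forall j \near \oo, normc (l i - x j i) <= e / n.+1%:R.
    have /cvgrPdist_lt := xl i; move=> /(_ (e / n.+1%:R)%:C%C).
    rewrite ltcR divr_gt0 // => /(_ isT); apply: filterS => j.
    by rewrite normc_normE ltcR => /ltW.
  have : \forall j \near \oo, forall i : 'I_n, normc (l i - x j i) <= e / n.+1%:R.
    exact: filter_forall.
  move=> [j0 _ /(_ (j0 + k)%N (leq_addr _ _)) hj].
  have -> : t =
      trunc (fun i => l i - x (j0 + k)%N i) n + trunc (x (j0 + k)%N - x k : ell2 R) n.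
    apply: ell2_ext => i; rewrite ell2D !truncE; case: ifP => _; last by rewrite addr0.
    by rewrite ell2B addrA subrK.
  apply: (le_trans (norm2D_le _ _)); rewrite addrC lerD //.
    by apply: (le_trans (trunc_le _ _)); rewrite addnC.
  rewrite -[e]ger0_norm ?(ltW e0) // -sqrtr_sqr -[leLHS]ger0_norm ?norm2_ge0 //.
  rewrite -sqrtr_sqr ler_wsqrtr // norm2_truncE.
  apply: (@le_trans _ _ (\sum_(0 <= i < n) (e / n.+1%:R) ^+ 2)).
    apply: ler_sum_nat => i /andP[_ ni].
    rewrite ler_sqr ?nnegrE ?normc_ge0 ?divr_ge0 ?(ltW e0) //.
    exact: (hj (Ordinal ni)).
  rewrite sumr_const_nat subn0 exprMn -mulrnAr ler_piMr ?sqr_ge0 //.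
  rewrite exprVn -[_ *+ n]mulr_natr mulrC ler_pdivrMr ?mul1r ?exprn_gt0 //.
  rewrite -natrX ler_nat (leq_trans (leqnSn n)) // expnS expn1 leq_pmulr //.
have ls : square_summable (fun i => l i - x 0%N i).
  apply: (@square_summable_bounded _ _ ((2 * c / 2 ^+ 0) ^+ 2)) => n.
  apply: le_trans (bound 0%N n); rewrite le_eqVlt; apply/orP; left; apply/eqP.
  rewrite /series /=; apply: eq_big_nat => i /andP[_ ni].
  by rewrite /sq_norms /= /truncation ni.
have ls' : square_summable l.
  have := square_summableD ls (@ell2_summable R (x 0%N)).
  by congr square_summable; apply/funext => i; rewrite /= !fctE subrK.
have lP : l \in @square_summableb R by apply/asboolP.
exists (Ell2 lP) => k; apply: norm2_le => [|n]; first by rewrite divr_ge0 ?mulr_ge0 // exprn_ge0.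
apply: le_trans (bound k n); rewrite le_eqVlt; apply/orP; left; apply/eqP.
rewrite /series /=; apply: eq_big_nat => i /andP[_ ni].
by rewrite /sq_norms /= /truncation ni.
Qed.

End ell2_theory.

(** * Positive contractions and their adjoints *)

Section positive_contractions.
Variable R : realType.
Implicit Types (x y z : ell2 R) (T : pos_contraction R).

Local Notation normc := (@Normc.normc R).

Lemma linear_of (f : ell2 R -> ell2 R) :
  (forall (a : R[i]) x y, f (a *: x + y) = a *: f x + f y) ->
  {g : {linear ell2 R -> ell2 R} | forall x, g x = f x}.
Proof.
move=> fl; pose h := GRing.isLinear.Build R[i] (ell2 R) (ell2 R) _ f fl.
by exists (HB.pack_for {linear ell2 R -> ell2 R} f h).
Qed.

Lemma pos_contraction_of (f : ell2 R -> ell2 R) :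
  (forall (a : R[i]) x y, f (a *: x + y) = a *: f x + f y) ->
  positive_op f -> (forall x, norm2 (f x) <= norm2 x) ->
  {T : pos_contraction R | forall x, T x = f x}.
Proof.
move=> /linear_of[g gf] fp fn.
have gp : positive_op g by move=> x x0; rewrite gf; exact: fp.
have gn : (opnorm g <= 1)%E.
  apply: ge_ereal_sup => _ [x /= x1 <-]; rewrite lee_fin gf.
  exact: le_trans (fn x) x1.
by exists (PosContraction gp gn).
Qed.

Lemma contraction T x : norm2 (T x) <= norm2 x.
Proof. by apply: opnorm_le1; exact: pos_contraction_opnorm. Qed.

Lemma iter_contraction T n x : norm2 (iter n T x) <= norm2 x.
Proof. by elim: n => //= n; apply: le_trans; exact: contraction. Qed.

Lemma iterD T n y z : iter n T (y + z) = iter n T y + iter n T z.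
Proof. by elim: n => // n IHn; rewrite !iterS IHn linearD. Qed.

Lemma adjoint_coord T y i : adjoint T y i = conjc (dot (T (ell2_basis R i)) y).
Proof.
by rewrite dot_adjoint_pos_contraction dot_basisl conjcK.
Qed.

Lemma adjoint_basis T i j :
  adjoint T (ell2_basis R i) j = conjc (T (ell2_basis R j) i).
Proof. by rewrite adjoint_coord dot_basisr. Qed.

Lemma dot_inj y z : (forall x, dot x y = dot x z) -> y = z.
Proof.
move=> yz; apply: ell2_ext => n; apply: (can_inj (@conjcK R)).
by rewrite -!dot_basisl.
Qed.

Lemma adjointE T (f : ell2 R -> ell2 R) :
  (forall x y, dot (T x) y = dot x (f y)) -> forall y, adjoint T y = f y.
Proof.
by move=> Tf y; apply: dot_inj => x; rewrite -dot_adjoint_pos_contraction.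
Qed.

Lemma complex_ge0P (a : R[i]) :
  (0 <= a) <-> (0 <= complex.Re a /\ complex.Im a = 0).
Proof.
case: a => b c; rewrite lecE /=; split.
  by move=> /andP[/eqP -> ->].
by move=> [-> ->]; rewrite eqxx.
Qed.

Lemma conjc_nonneg (a : R[i]) : 0 <= a -> conjc a = a.
Proof. by case: a => b c /complex_ge0P[/= _ ->]; rewrite oppr0. Qed.

Lemma conjc_ge0 (a : R[i]) : 0 <= a -> 0 <= conjc a.
Proof. by move=> a0; rewrite conjc_nonneg. Qed.

Lemma nonneg_normc (a : R[i]) : 0 <= a -> a = (normc a)%:C%C.
Proof. by move=> a0; rewrite -normc_normE ger0_norm. Qed.

Lemma normc_le (a b : R[i]) : 0 <= a -> a <= b -> normc a <= normc b.
Proof.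
move=> a0 ab; rewrite -lecR -!normc_normE ger0_norm // ger0_norm //.
exact: le_trans ab.
Qed.

(** The order of the complex numbers is partial, so that the real and the
    imaginary part are treated separately. *)
Lemma limC_ge0 (u : nat -> R[i]^o) (l : R[i]^o) : u @ \oo --> l ->
  (forall n, 0 <= (u n : R[i])) -> 0 <= (l : R[i]).
Proof.
move=> ul u0.
have close (e : R) : 0 < e -> exists n, normc (l - u n) < e.
  move=> e0; move/cvgrPdist_lt : ul => /(_ e%:C%C); rewrite ltcR => /(_ e0).
  move=> [n _ /(_ n (leqnn n))] /=; rewrite normc_normE ltcR => h.
  by exists n.
apply/complex_ge0P; split.
  rewrite leNgt; apply/negP => l0.
  have [|n] := close (- complex.Re l); first by rewrite oppr_gt0.
  have := normc_Re (l - u n); have /complex_ge0P[] := u0 n.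
  case: (u n) (l) => a b [c d] /= a0 _ h1 h2.
  have := le_lt_trans h1 h2; rewrite ltr_norml => /andP[h3 _].
  by move: h3; rewrite opprK => h3; lra.
apply/eqP/negPn/negP => l0.
have [|n] := close (`|complex.Im l|); first by rewrite normr_gt0.
have := normc_Im (l - u n); have /complex_ge0P[] := u0 n.
case: (u n) (l) => a b [c d] /= _ -> h1 h2.
by have := le_lt_trans h1 h2; rewrite oppr0 addr0 ltxx.
Qed.

Lemma dot_ge0 x y : nonneg_vec x -> nonneg_vec y -> 0 <= dot x y.
Proof.
move=> x0 y0; apply: (limC_ge0 (@dot_series R x y)) => n.
by apply: sumr_ge0 => k _; rewrite mulr_ge0 // conjc_ge0.
Qed.

Lemma basis_ge0 n : nonneg_vec (ell2_basis R n).
Proof. by move=> k; rewrite basisE ler0n. Qed.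

Lemma nonneg_vecD x y : nonneg_vec x -> nonneg_vec y -> nonneg_vec (x + y).
Proof. by move=> x0 y0 n; rewrite ell2D addr_ge0. Qed.

Lemma nonneg_vecZ (a : R[i]) x : 0 <= a -> nonneg_vec x -> nonneg_vec (a *: x).
Proof. by move=> a0 x0 n; rewrite ell2Z mulr_ge0. Qed.

Lemma nonneg_trunc x m : nonneg_vec x -> nonneg_vec (trunc x m).
Proof. by move=> x0 n; rewrite truncE; case: ifP. Qed.

Lemma adjoint_pos_contraction T :
  {S : pos_contraction R | forall y, S y = adjoint T y}.
Proof.
apply: pos_contraction_of => [a x y|y y0 n|y].
- apply: dot_inj => z; rewrite dotDr dotZr -!dot_adjoint_pos_contraction.
  by rewrite dotDr dotZr.
- rewrite adjoint_coord conjc_ge0 // dot_ge0 //.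
  by apply: pos_contraction_pos; exact: basis_ge0.
- have [->|/eqP y0] := eqVneq (norm2 (adjoint T y)) 0; first exact: norm2_ge0.
  have a0 : 0 < norm2 (adjoint T y) by rewrite lt_neqAle eq_sym norm2_ge0; apply/andP; split => //; apply/eqP.
  rewrite -(ler_pM2l a0) -expr2.
  rewrite -[leLHS]normc_real ?sqr_ge0 // -dotxx -dot_adjoint_pos_contraction.
  apply: (le_trans (dot_CauchySchwarz _ _)).
  by apply: ler_wpM2r; [exact: norm2_ge0|exact: contraction].
Qed.

Definition adj T : pos_contraction R := sval (adjoint_pos_contraction T).

Lemma adjE T y : adj T y = adjoint T y.
Proof. exact: (svalP (adjoint_pos_contraction T)). Qed.

Lemma dot_adj T x y : dot (T x) y = dot x (adj T y).
Proof. by rewrite adjE dot_adjoint_pos_contraction. Qed.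

Lemma adjK T : adj (adj T) = T.
Proof.
apply: pos_contraction_ext => x; apply: dot_inj => y.
by rewrite -dot_adj dotC -dot_adj -dotC.
Qed.

End positive_contractions.

(** * The defect form and the residual *)

Section defect_form.
Variable R : realType.
Implicit Types (x y z w : ell2 R) (T : pos_contraction R).

Local Notation normc := (@Normc.normc R).

(** The semi-inner product of the operator [1 - T^* T], written without the
    adjoint so that it depends continuously on [T] for the strong topology. *)
Definition defect T z w : R[i] := dot z w - dot (T z) (T w).

Lemma defectxx T z :
  defect T z z = (norm2 z ^+ 2 - norm2 (T z) ^+ 2)%:C%C.
Proof. by rewrite /defect !dotxx -rmorphB. Qed.

Lemma defect_le T z : norm2 z ^+ 2 - norm2 (T z) ^+ 2 <= norm2 z ^+ 2.
Proof. by rewrite gerBl sqr_ge0. Qed.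

Lemma defect_ge0 T z : 0 <= norm2 z ^+ 2 - norm2 (T z) ^+ 2.
Proof. by rewrite subr_ge0 ler_sqr ?nnegrE ?norm2_ge0 // contraction. Qed.

Lemma defectDl T x y w : defect T (x + y) w = defect T x w + defect T y w.
Proof. by rewrite /defect linearD !dotDl; ring. Qed.

Lemma defectZl T (a : R[i]) x w : defect T (a *: x) w = a * defect T x w.
Proof. by rewrite /defect linearZ !dotZl; ring. Qed.

Lemma defectDr T x y w : defect T w (x + y) = defect T w x + defect T w y.
Proof. by rewrite /defect linearD !dotDr; ring. Qed.

Lemma defectZr T (a : R[i]) x w : defect T w (a *: x) = conjc a * defect T w x.
Proof. by rewrite /defect linearZ !dotZr; ring. Qed.

Lemma defectC T x y : defect T y x = conjc (defect T x y).
Proof. by rewrite /defect [dot y x]dotC [dot (T y) _]dotC -rmorphB. Qed.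

(** The form [defect T] is positive semidefinite because [T] is a contraction,
    and it is bounded by the inner product. *)
Lemma defect_CauchySchwarz T z w :
  normc (defect T z w) ^+ 2 <=
    (norm2 z ^+ 2 - norm2 (T z) ^+ 2) * norm2 w ^+ 2.
Proof.
have [w0|w0] := eqVneq (norm2 w) 0.
  rewrite (norm2_ell2_eq0 w0) /defect linear0 !dot0r subrr Normc.normc0 norm2_0.
  by rewrite expr0n /= mulr0.
set p := defect T z w; set P := normc p ^+ 2; set K := norm2 w ^+ 2.
have K0 : 0 < K by rewrite exprn_gt0 // lt_neqAle eq_sym w0 norm2_ge0.
(* The best [t] would be the inverse of [defect T w w], which may vanish; it is
   enough to use the upper bound [K] of the latter. *)
pose t := K^-1; pose v := z + (- (t%:C%C * p)) *: w.
have pP : p * conjc p = P%:C%C.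
  by rewrite /P rmorphXn /= -normc_normE sqr_normc.
have E : (norm2 v ^+ 2 - norm2 (T v) ^+ 2)%:C%C =
    (norm2 z ^+ 2 - norm2 (T z) ^+ 2 - 2 * t * P
       + t ^+ 2 * P * (norm2 w ^+ 2 - norm2 (T w) ^+ 2))%:C%C.
  rewrite -defectxx /v defectDl !defectDr !defectZl !defectZr.
  rewrite (defectC T z w) -/p [defect T w w]defectxx [defect T z z]defectxx.
  have cE : conjc (- (t%:C%C * p)) = - (t%:C%C * conjc p).
    by rewrite rmorphN rmorphM; congr (- (_ * _)); exact: conjc_real.
  have rE (a b c d : R) : (a - 2 * b * c + b ^+ 2 * c * d)%:C%C =
      a%:C%C - 2 * b%:C%C * c%:C%C + b%:C%C ^+ 2 * c%:C%C * d%:C%C :> R[i].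
    rewrite (rmorphD (real_complex R)) (rmorphB (real_complex R)).
    by rewrite !expr2 !(rmorphM (real_complex R)) (rmorph_nat (real_complex R)).
  by rewrite cE rE -pP; ring.
have := defect_ge0 T v.
move/(congr1 (@complex.Re R)) : E => /= ->.
move: (defect_le T w); rewrite /t -/K; set W := K - _.
set Z := norm2 z ^+ 2 - _ => WK h.
have : 0 <= Z - K^-1 * P.
  apply: (le_trans h); have : K^-1 ^+ 2 * P * W <= K^-1 ^+ 2 * P * K.
    by apply: ler_wpM2l => //; rewrite mulr_ge0 // sqr_ge0.
  have -> : K^-1 ^+ 2 * P * K = K^-1 * P by field; rewrite gt_eqF.
  by lra.
by rewrite subr_ge0 mulrC ler_pdivrMr.
Qed.

(** By Cauchy-Schwarz each term is at most [(|T^n x|^2 - |T^n.+1 x|^2) |w|^2],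
    and these differences telescope. *)
Lemma sum_defect_le T x w a b : (a <= b)%N ->
  \sum_(a <= n < b) normc (defect T (iter n T x) w) ^+ 2 <=
    (norm2 (iter a T x) * norm2 w) ^+ 2.
Proof.
move=> ab; pose u n := norm2 (iter n T x) ^+ 2.
apply: (@le_trans _ _ (\sum_(a <= n < b) (u n - u n.+1) * norm2 w ^+ 2)).
  by apply: ler_sum => n _; exact: defect_CauchySchwarz.
rewrite -mulr_suml exprMn; apply: ler_wpM2r; first exact: sqr_ge0.
have -> : \sum_(a <= n < b) (u n - u n.+1) = u a - u b.
  rewrite -[RHS]opprB -(telescope_sumr u ab) -sumrN.
  by apply: eq_bigr => n _; rewrite opprB.
by rewrite gerBl sqr_ge0.
Qed.

(** The residual bounds the square sum of all the [defect T (T^n x) w], [1 <= n],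
    but involves only finitely many powers of [T]: its last term controls the
    tail. *)
Definition residual T x w N : R :=
  \sum_(1 <= n < N.+1) normc (defect T (iter n T x) w) ^+ 2
  + (norm2 (iter N.+1 T x) * norm2 w) ^+ 2.

Lemma sum_defect_residual T x w N M :
  \sum_(1 <= n < M.+1) normc (defect T (iter n T x) w) ^+ 2 <= residual T x w N.
Proof.
have [MN|/ltnW NM] := leqP M N.
  apply: ler_wpDr; first exact: sqr_ge0.
  rewrite [leRHS](big_cat_nat (n := M.+1)) //=.
  by rewrite lerDl sumr_ge0 // => n _; exact: sqr_ge0.
rewrite (big_cat_nat (n := N.+1)) //= lerD2l; exact: sum_defect_le.
Qed.

Lemma defect_residual T x w N n : (0 < n)%N ->
  normc (defect T (iter n T x) w) ^+ 2 <= residual T x w N.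
Proof.
move=> n0; apply: le_trans (sum_defect_residual T x w N n).
by rewrite big_nat_recr //= lerDr sumr_ge0 // => i _; exact: sqr_ge0.
Qed.

End defect_form.

(** * Continuity of the residual *)

Section residual_continuity.
Variables (R : realType) (S : Type) (F : set_system S).
Context {FF : Filter F}.

Local Notation normc := (@Normc.normc R).

(** Norm convergence, stated with real-valued norms since the norm of the normed
    module [ell2 R] is complex-valued; see [ell2_cvgP]. *)
Definition ell2_cvg (u : S -> ell2 R) (v : ell2 R) : Prop :=
  norm2 (u s - v) @[s --> F] --> (0 : R).

Lemma cvg_squeeze0 (f g : S -> R) : (forall s, 0 <= f s) ->
  (forall s, f s <= g s) -> g @ F --> (0 : R) -> f @ F --> (0 : R).
Proof.
move=> f0 fg; apply: (@squeeze_cvgr _ _ _ _ (fun=> 0)); last exact: cvg_cst.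
by apply: nearW => s; rewrite f0 fg.
Qed.

Lemma cvg_sqr (f : S -> R) (l : R) : f @ F --> l ->
  f s ^+ 2 @[s --> F] --> l ^+ 2.
Proof. by move=> fl; exact: (cvgM fl fl). Qed.

Lemma ell2_cvg_cst v : ell2_cvg (fun=> v) v.
Proof. by rewrite /ell2_cvg subrr norm2_0; exact: cvg_cst. Qed.

Lemma cvg_norm2 u v : ell2_cvg u v -> norm2 (u s) @[s --> F] --> norm2 v.
Proof.
move=> uv; apply/cvgrPdist_le => e e0.
move/cvgrPdist_le : uv => /(_ e e0); apply: filterS => s.
rewrite sub0r normrN ger0_norm ?norm2_ge0 // => h.
by rewrite distrC (le_trans (ler_norm2B _ _)).
Qed.

Lemma cvg_normc (f : S -> R[i]) l : normc (f s - l) @[s --> F] --> (0 : R) ->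
  normc (f s) @[s --> F] --> normc l.
Proof.
move=> fl; apply/cvgrPdist_le => e e0.
move/cvgrPdist_le : fl => /(_ e e0); apply: filterS => s.
rewrite sub0r normrN ger0_norm ?normc_ge0 // => h.
by rewrite distrC (le_trans (ler_normcB _ _)).
Qed.

Lemma cvg_dot u v u' v' : ell2_cvg u v -> ell2_cvg u' v' ->
  normc (dot (u s) (u' s) - dot v v') @[s --> F] --> (0 : R).
Proof.
move=> uv uv'.
apply: (@cvg_squeeze0 _ (fun s => norm2 (u s - v) * norm2 (u' s)
                            + norm2 v * norm2 (u' s - v'))).
- by move=> s; exact: normc_ge0.
- move=> s; have -> : dot (u s) (u' s) - dot v v' =
      dot (u s - v) (u' s) + dot v (u' s - v') by rewrite dotBl dotBr; ring.
  apply: (le_trans (le_normcD _ _)).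
  by apply: lerD; exact: dot_CauchySchwarz.
- have := cvgD (cvgM uv (cvg_norm2 uv')) (cvgM (cvg_cst (norm2 v)) uv').
  by rewrite mul0r mulr0 addr0; apply.
Qed.

Variables (T : S -> pos_contraction R) (T0 : pos_contraction R).
Hypothesis TT0 : forall z, ell2_cvg (fun s => T s z) (T0 z).

Lemma ell2_cvg_op u v : ell2_cvg u v -> ell2_cvg (fun s => T s (u s)) (T0 v).
Proof.
move=> uv.
apply: (@cvg_squeeze0 _ (fun s => norm2 (u s - v) + norm2 (T s v - T0 v))).
- by move=> s; exact: norm2_ge0.
- move=> s; apply: (le_trans (norm2_triangle (T s v) _ _)).
  by rewrite -linearB lerD2r contraction.
- by rewrite -(addr0 (0 : R)); apply: cvgD => //; exact: TT0.
Qed.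

Lemma ell2_cvg_iter n u v : ell2_cvg u v ->
  ell2_cvg (fun s => iter n (T s) (u s)) (iter n T0 v).
Proof. by move=> uv; elim: n => //= n; exact: ell2_cvg_op. Qed.

Lemma cvg_defect u v u' v' : ell2_cvg u v -> ell2_cvg u' v' ->
  normc (defect (T s) (u s) (u' s) - defect T0 v v') @[s --> F] --> (0 : R).
Proof.
move=> uv uv'.
have h1 := cvg_dot uv uv'.
have h2 := cvg_dot (ell2_cvg_op uv) (ell2_cvg_op uv').
apply: (@cvg_squeeze0 _ (fun s => normc (dot (u s) (u' s) - dot v v') +
    normc (dot (T s (u s)) (T s (u' s)) - dot (T0 v) (T0 v')))).
- by move=> s; exact: normc_ge0.
- move=> s; rewrite /defect (_ : _ - _ - _ = (dot (u s) (u' s) - dot v v')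
    - (dot (T s (u s)) (T s (u' s)) - dot (T0 v) (T0 v'))); last by ring.
  by apply: (le_trans (le_normcD _ _)); rewrite normcN.
- by rewrite -(addr0 (0 : R)); exact: (cvgD h1 h2).
Qed.

Lemma cvg_residual N u v u' v' : ell2_cvg u v -> ell2_cvg u' v' ->
  residual (T s) (u s) (u' s) N @[s --> F] --> residual T0 v v' N.
Proof.
move=> uv uv'; apply: cvgD.
  elim: N => [|N IHN].
    by rewrite big_geq //; under eq_fun do rewrite big_geq //; exact: cvg_cst.
  rewrite big_nat_recr //=; under eq_fun do rewrite big_nat_recr //=.
  apply: cvgD => //; apply: cvg_sqr; apply: cvg_normc; apply: cvg_defect => //.
  exact: ell2_cvg_op (ell2_cvg_iter _ uv).
apply: cvg_sqr.
by apply: cvgM; apply: cvg_norm2 => //; exact: (@ell2_cvg_iter N.+1).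
Qed.

End residual_continuity.

(** * Neighbourhoods in the two operator topologies *)

Section operator_topologies.
Variable R : realType.
Implicit Types (x y z w : ell2 R) (T S : pos_contraction R).

Local Notation normc := (@Normc.normc R).
Local Notation e_ := (@ell2_basis R).

Lemma op_approx S T x m : norm2 (S x - T x) <=
  2 * norm2 (x - trunc x m)
  + \sum_(0 <= i < m) normc (x i) * norm2 (S (e_ i) - T (e_ i)).
Proof.
set r := x - trunc x m.
have -> : S x - T x = (S r - T r) + (S (trunc x m) - T (trunc x m)).
  by rewrite addrACA -opprD -!linearD subrK.
apply: (le_trans (norm2D_le _ _)); apply: lerD.
  apply: (le_trans (norm2B_le _ _)); rewrite mulrDl mul1r.
  by apply: lerD; exact: contraction.
clear; elim: m => [|m IHm].
  by rewrite Defs.trunc0 (linear0 S) (linear0 T) subrr norm2_0 big_nil.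
have -> : S (trunc x m.+1) - T (trunc x m.+1) =
    (S (trunc x m) - T (trunc x m)) + x m *: (S (e_ m) - T (e_ m)).
  by rewrite truncS (linearD S) (linearD T) !linearZ /= opprD addrACA -scalerBr addrC.
apply: (le_trans (norm2D_le _ _)).
by rewrite big_nat_recr // norm2_ell2Z lerD2r.
Qed.

(** Contractions are equicontinuous and the basis spans a dense subspace. *)
Lemma ell2_cvg_basis (U : Type) (F : set_system U) {FF : Filter F}
    (T : U -> pos_contraction R) T0 :
  (forall i, ell2_cvg F (fun s => T s (e_ i)) (T0 (e_ i))) ->
  forall z, ell2_cvg F (fun s => T s z) (T0 z).
Proof.
move=> Te z; apply/cvgrPdist_le => e e0.
have [|m zm] := norm2_tail_small z (e := e / 4); first by rewrite divr_gt0.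
have h : \sum_(0 <= i < m) normc (z i) * norm2 (T s (e_ i) - T0 (e_ i))
    @[s --> F] --> (0 : R).
  elim: m {zm} => [|m IHm].
    by under eq_fun do rewrite big_nil; exact: cvg_cst.
  have h : normc (z m) * norm2 (T s (e_ m) - T0 (e_ m)) @[s --> F] --> (0 : R).
    by rewrite -[X in _ --> X](mulr0 (normc (z m))); exact: (cvgM (cvg_cst _) (Te m)).
  rewrite [X in X @ _](_ : _ = fun s => \sum_(0 <= i < m)
      normc (z i) * norm2 (T s (e_ i) - T0 (e_ i))
      + normc (z m) * norm2 (T s (e_ m) - T0 (e_ m))); last first.
    by apply/funext => s; rewrite big_nat_recr.
  by rewrite -[X in _ --> X](addr0 (0 : R)); exact: (cvgD IHm h).
move/cvgrPdist_le : h => /(_ (e / 2)); rewrite divr_gt0 // => /(_ isT).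
apply: filterS => s; rewrite !sub0r !normrN => hs.
rewrite ger0_norm ?norm2_ge0 //; apply: (le_trans (op_approx _ _ _ m)).
have := zm m (leqnn m); have := le_trans (ler_norm _) hs; lra.
Qed.

Lemma ell2_cvgP (U : Type) (F : set_system U) {FF : Filter F}
    (u : U -> ell2 R) v : ell2_cvg F u v <-> u @ F --> v.
Proof.
split => [uv|/cvgrPdist_le uv].
  apply/cvgrPdist_le => e e0.
  have [r er] : exists r : R, e = r%:C%C by apply/complex_realP; exact: gtr0_real.
  have r0 : 0 < r by rewrite -ltcR -er.
  move/cvgrPdist_le : uv => /(_ _ r0); apply: filterS => s.
  rewrite sub0r normrN ger0_norm ?norm2_ge0 // => h.
  by rewrite ell2_normE er lecR norm2B.
apply/cvgrPdist_le => e e0; have := uv e%:C%C; rewrite ltcR => /(_ e0).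
apply: filterS => s; rewrite ell2_normE lecR sub0r normrN ger0_norm ?norm2_ge0 //.
by rewrite norm2B.
Qed.

(** These sets form a base of neighbourhoods of [T0] for the strong-star topology,
    see [SOTstar_sotball]. *)
Definition sotball T0 n (e : R) : set (pos_contraction R) :=
  [set S : pos_contraction R | forall i, (i < n)%N -> norm2 (S (e_ i) - T0 (e_ i)) < e /\
                       norm2 (adj S (e_ i) - adj T0 (e_ i)) < e].

Let sotballs T0 : set_system (pos_contraction R) :=
  [set A | exists n e, 0 < e /\ sotball T0 n e `<=` A].

Let sotballs_filter T0 : Filter (sotballs T0).
Proof.
split.
- by exists 0%N, 1.
- move=> A B [n [e [e0 nA]]] [m [d [d0 mB]]].
  exists (maxn n m), (Num.min e d); split; first by rewrite lt_min e0.
  move=> S TS; split.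
    apply: nA => i ni; have [|h1 h2] := TS i; first by rewrite leq_max ni.
    by move: h1 h2; rewrite !lt_min => /andP[-> _] /andP[-> _].
  apply: mB => i ni; have [|h1 h2] := TS i; first by rewrite leq_max ni orbT.
  by move: h1 h2; rewrite !lt_min => /andP[_ ->] /andP[_ ->].
- by move=> A B AB [n [e [e0 nA]]]; exists n, e; split => // S /nA /AB.
Qed.

Lemma SOTstar_sotball (O : set (pos_contraction R)) T0 :
  @open (SOTstar R) O -> O T0 ->
  exists n e, 0 < e /\ sotball T0 n e `<=` O.
Proof.
move=> [A oA <-] AT0; pose FF := sotballs_filter T0.
have cv : (@orbit_maps R) @ sotballs T0 -->
    (orbit_maps T0 : {ptws ell2 R -> (ell2 R * ell2 R)%type}).
  apply/pointwise_cvgP => x /=.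
  have near i e : 0 < e -> sotballs T0
      [set S : pos_contraction R | norm2 (S (e_ i) - T0 (e_ i)) < e /\
               norm2 (adj S (e_ i) - adj T0 (e_ i)) < e].
    move=> e0; exists i.+1, e; split => // S TS.
    by have [] := TS i (leqnn _).
  have c1 : (fun S : pos_contraction R => S x) @ sotballs T0 --> T0 x.
    apply/ell2_cvgP; apply: ell2_cvg_basis => i; apply/cvgrPdist_lt => e e0.
    apply: filterS (near i e e0) => S [h _].
    by rewrite sub0r normrN ger0_norm ?norm2_ge0.
  have c2 : (fun S : pos_contraction R => adjoint S x) @ sotballs T0
      --> adjoint T0 x.
    apply/ell2_cvgP.
    suff : ell2_cvg (sotballs T0) (fun S => adj S x) (adj T0 x).
      rewrite /ell2_cvg adjE; apply: cvg_trans; apply: near_eq_cvg.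
      by apply: nearW => S /=; rewrite adjE.
    apply: (@ell2_cvg_basis _ _ _ (@adj R)) => i; apply/cvgrPdist_lt => e e0.
    apply: filterS (near i e e0) => S [_ h].
    by rewrite sub0r normrN ger0_norm ?norm2_ge0.
  exact: (cvg_pair c1 c2).
by apply: cv; exact: open_nbhs_nbhs.
Qed.

Lemma SOTstar_ell2_cvg (T0 : SOTstar R) z :
  ell2_cvg (nbhs T0) (fun S : pos_contraction R => S z)
    ((T0 : pos_contraction R) z).
Proof.
have c : (@orbit_maps R) @ nbhs T0 --> (orbit_maps T0 : {ptws _ -> _}).
  exact: (@initial_continuous _ _ (@orbit_maps R) T0).
have [/(_ c z) h _] :=
  @pointwise_cvgP (ell2 R) (ell2 R * ell2 R)%type ((@orbit_maps R) @ nbhs T0)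
    (orbit_maps T0) _.
apply/ell2_cvgP => A TA; apply: (h (fst @^-1` A)).
by exists (A, setT) => [|[u v] []] //=; split => //; exact: filterT.
Qed.

Lemma residual_open x w N (c : R) :
  @open (SOTstar R) [set T : pos_contraction R | residual T x w N < c].
Proof.
rewrite openE => T0 /= T0c.
have h : residual T x w N @[T --> nbhs T0] --> residual T0 x w N.
  apply: (@cvg_residual _ _ _ _ (fun T : pos_contraction R => T)).
  - exact: SOTstar_ell2_cvg.
  - exact: ell2_cvg_cst.
  - exact: ell2_cvg_cst.
exact: (h [set r : R | r < c] (lt_nbhsl T0c)).
Qed.

Lemma WOT_coef_open x y (c : R[i]) (g : R) :
  @open (WOT R) [set T : pos_contraction R | normc (dot (T x) y - c) < g].
Proof.
pose A : set R[i]^o := [set a : R[i]^o | normc (conjc a - c) < g].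
have oA : open A.
  rewrite openE => a /= Aa; apply/nbhs_ballP.
  exists (g - normc (conjc a - c))%:C%C => /=; first by rewrite ltcR subr_gt0.
  move=> b; rewrite /ball /= normc_normE ltcR => ab.
  change (normc (conjc b - c) < g).
  have -> : conjc b - c = (conjc b - conjc a) + (conjc a - c) by rewrite subrKA.
  apply: (le_lt_trans (le_normcD _ _)); rewrite -ltrBrDr; apply: le_lt_trans ab.
  by rewrite -rmorphB [normc (conjc _)]Defs.normcJ normcB.
exists [set f : {ptws (ell2 R * ell2 R)%type -> R[i]^o} | A (f (x, y))].
  have c1 := @proj_continuous (ell2 R * ell2 R)%type (fun=> R[i]^o) (x, y).
  exact: (@open_comp {ptws (ell2 R * ell2 R)%type -> R[i]^o} R[i]^o _ A
    (fun f _ => c1 f) oA).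
apply/seteqP; split => T; rewrite /A /= /matrix_coefficients;
  by rewrite [dot (x, y).2 _]dotC conjcK.
Qed.

End operator_topologies.

(** * Norm attaining contractions *)

Section norm_attaining.
Variable R : realType.
Implicit Types (x y z u v : ell2 R) (T S : pos_contraction R).

Local Notation normc := (@Normc.normc R).
Local Notation e_ := (@ell2_basis R).

Lemma sum_dot_nonneg_le x y n : nonneg_vec x -> nonneg_vec y ->
  \sum_(0 <= k < n) normc (x k) * normc (y k) <= normc (dot x y).
Proof.
move=> x0 y0.
have part : dot x (trunc y n) = (\sum_(0 <= k < n) normc (x k) * normc (y k))%:C%C.
  rewrite dot_truncr rmorph_sum; apply: eq_bigr => k _.
  by rewrite conjc_nonneg // {1}(nonneg_normc (x0 k)) {1}(nonneg_normc (y0 k)) -rmorphM.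
have s0 : 0 <= \sum_(0 <= k < n) normc (x k) * normc (y k).
  by apply: sumr_ge0 => k _; rewrite mulr_ge0 ?normc_ge0.
rewrite -(normc_real s0) -part; apply: normc_le.
  by apply: dot_ge0 => //; exact: nonneg_trunc.
rewrite -subr_ge0 -dotBr; apply: dot_ge0 => // k.
by rewrite ell2B truncE; case: ifP => _; rewrite ?subrr ?subr0.
Qed.

(** Cauchy-Schwarz for the weights [t j], applied to the square root of [b j] and
    to [a j] divided by it. *)
Lemma weighted_CauchySchwarz (t a b : nat -> R) M :
  (forall j, 0 <= t j) -> (forall j, (j < M)%N -> 0 < b j) ->
  (\sum_(0 <= j < M) t j * a j) ^+ 2 <=
  (\sum_(0 <= j < M) t j * b j) * (\sum_(0 <= j < M) t j * (a j ^+ 2 / b j)).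
Proof.
move=> t0 b0.
set P := \sum_(0 <= j < M) t j * b j; set Q := \sum_(0 <= j < M) t j * (_ / _).
have P0 : 0 <= P.
  rewrite /P big_nat_cond; apply: sumr_ge0 => j /andP[/andP[_ jM] _].
  by rewrite mulr_ge0 // ltW // b0.
have Q0 : 0 <= Q.
  rewrite /Q big_nat_cond; apply: sumr_ge0 => j /andP[/andP[_ jM] _].
  by rewrite mulr_ge0 // divr_ge0 ?sqr_ge0 // ltW // b0.
have lin (r : R) : 2 * r * (\sum_(0 <= j < M) t j * a j) <= r ^+ 2 * P + Q.
  rewrite /P /Q !mulr_sumr -big_split /=; apply: ler_sum_nat => j /andP[_ jM].
  have bj := b0 j jM; rewrite -subr_ge0.
  rewrite (_ : _ - _ = t j * ((r * b j - a j) ^+ 2 / b j)); last first.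
    by field; rewrite gt_eqF.
  by rewrite mulr_ge0 // divr_ge0 ?sqr_ge0 // ltW.
set s := \sum_(0 <= j < M) t j * a j in lin *.
have [P1|P1] := ltrP 0 P.
  have := lin (s / P); rewrite expr2.
  have -> : 2 * (s / P) * s = 2 * (s ^+ 2 / P) by ring.
  have -> : s / P * (s / P) * P = s ^+ 2 / P by field; rewrite gt_eqF.
  move=> h; have : s ^+ 2 / P <= Q by lra.
  by rewrite ler_pdivrMr // mulrC.
have P2 : P = 0 by apply/le_anti; rewrite P1.
have -> : s = 0.
  apply/eqP/negPn/negP => s0; have := lin ((Q + 1) / s); rewrite P2 mulr0 add0r.
  have -> : 2 * ((Q + 1) / s) * s = 2 * (Q + 1) by field.
  by lra.
by rewrite P2 mul0r expr0n.
Qed.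

(** Schur's test.  Weighting the entries [t i j] of [f] by [U], Cauchy-Schwarz
    bounds [|(f x)_i|^2] by [V_i] times the sum over [j] of
    [t i j |x_j|^2 / U_j]; summing over [i] with [g V = U] leaves [|x|^2]. *)
Lemma Schur_test (f g : ell2 R -> ell2 R) (U V : ell2 R) M :
  (forall (a : R[i]) x y, f (a *: x + y) = a *: f x + f y) -> positive_op f ->
  (forall x y, dot (f x) y = dot x (g y)) ->
  nonneg_vec V -> (forall j, (j < M)%N -> 0 < U j) -> nonneg_vec U ->
  f U = V -> g V = U -> (forall x, f x = f (trunc x M)) ->
  forall x, norm2 (f x) <= norm2 x.
Proof.
move=> /linear_of[F Ff] fp fg V0 U0 Un fU gV fM x.
pose t i j := normc (f (e_ j) i).
have tE i j : f (e_ j) i = (t i j)%:C%C.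
  by apply: nonneg_normc; apply: fp; exact: basis_ge0.
have fE z i : f z i = \sum_(0 <= j < M) z j * (t i j)%:C%C.
  rewrite fM -Ff trunc_sum linear_sum ell2_sum; apply: eq_bigr => j _.
  by rewrite linearZ_LR ell2Z Ff tE.
pose U' j := normc (U j).
have U'0 j : (j < M)%N -> 0 < U' j.
  by move=> jM; rewrite -ltcR -normc_normE gtr0_norm ?U0.
have VE i : normc (V i) = \sum_(0 <= j < M) t i j * U' j.
  have s0 : 0 <= \sum_(0 <= j < M) t i j * U' j.
    by apply: sumr_ge0 => j _; rewrite mulr_ge0 ?normc_ge0.
  rewrite -(normc_real s0) -fU fE rmorph_sum /=; congr normc.
  apply: eq_bigr => j _.
  by rewrite {1}(nonneg_normc (Un j)) -rmorphM mulrC.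
have col j n : (j < M)%N -> \sum_(0 <= i < n) t i j * normc (V i) <= U' j.
  move=> jM; have := @sum_dot_nonneg_le (f (e_ j)) V n (fp _ (@basis_ge0 R j)) V0.
  by rewrite fg gV dot_basisl Defs.normcJ.
apply: norm2_le => [|n]; first exact: norm2_ge0.
apply: (@le_trans _ _ (\sum_(0 <= i < n)
    \sum_(0 <= j < M) normc (V i) * (t i j * (normc (x j) ^+ 2 / U' j)))).
  apply: ler_sum => i _; rewrite /sq_norms fE -mulr_sumr VE.
  apply: le_trans (weighted_CauchySchwarz (fun j => normc (x j)) _ U'0).
    rewrite ler_sqr ?nnegrE ?normc_ge0 //; last first.
      by apply: sumr_ge0 => j _; rewrite mulr_ge0 ?normc_ge0.
    rewrite -lecR -normc_normE (le_trans (ler_norm_sum _ _ _)) //.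
    rewrite rmorph_sum /=; apply: ler_sum => j _.
    by rewrite normrM !normc_normE normc_real ?normc_ge0 // mulrC -rmorphM.
  by move=> j; exact: normc_ge0.
rewrite exchange_big_nat /=.
apply: (@le_trans _ _ (\sum_(0 <= j < M) normc (x j) ^+ 2)).
  apply: ler_sum_nat => j /andP[_ jM].
  rewrite (_ : \sum_(_ <= _ < _) _ =
      (normc (x j) ^+ 2 / U' j) * \sum_(0 <= i < n) t i j * normc (V i)).
    rewrite -mulrA ler_piMr ?sqr_ge0 // ler_pdivrMl ?U'0 // mulr1.
    exact: col.
  by rewrite mulr_sumr; apply: eq_bigr => i _; ring.
exact: series_le_norm2 (@ell2_summable R x).
Qed.

(** If [<S U, V>] is nearly [|U||V|] then [S U] is nearly [V], and by positivity
    [S U] dominates [S e_i]: no mass of [S e_i] escapes to infinity, and weak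
    closeness, which controls finitely many coordinates, controls the norm. *)
Lemma norm_attaining_close S T (U V : ell2 R) M i (g d : R) :
  nonneg_vec U -> 1 <= U i -> norm2 V = norm2 U -> trunc V M = V ->
  trunc (T (e_ i)) M = T (e_ i) -> 0 <= g ->
  normc (dot (S U) V - (norm2 U ^+ 2)%:C%C) <= g ^+ 2 / 2 ->
  (forall j, (j < M)%N -> normc (S (e_ i) j - T (e_ i) j) <= d) ->
  norm2 (S (e_ i) - T (e_ i)) <= g + M%:R * d.
Proof.
move=> U0 Ui VU VM TM g0 SU head.
have SUV : norm2 (S U - V) <= g.
  rewrite -(ger0_norm g0) -sqrtr_sqr -[leLHS](ger0_norm (norm2_ge0 _)) -sqrtr_sqr.
  apply: ler_wsqrtr.
  have E : (norm2 (S U - V) ^+ 2)%:C%C = (norm2 (S U) ^+ 2)%:C%C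
      - dot (S U) V - conjc (dot (S U) V) + (norm2 V ^+ 2)%:C%C.
    by rewrite -!dotxx dotBl !dotBr [dot V (S U)]dotC; ring.
  move/(congr1 (@complex.Re R)) : E; rewrite VU.
  have := normc_Re (dot (S U) V - (norm2 U ^+ 2)%:C%C).
  have SUU : norm2 (S U) ^+ 2 <= norm2 U ^+ 2.
    by rewrite ler_sqr ?nnegrE ?norm2_ge0 // contraction.
  move: SU SUU; move: (norm2 (S U - V) ^+ 2) (norm2 (S U) ^+ 2) (norm2 U ^+ 2) => A B C.
  case: (dot (S U) V) => p q /=; rewrite ler_norml => h1 h2 /andP[h3 _] h4.
  by lra.
have dom k : normc (S (e_ i) k) <= normc (S U k).
  apply: normc_le; first by apply: pos_contraction_pos; exact: basis_ge0.
  rewrite -subr_ge0 -ell2B -linearB; apply: pos_contraction_pos => j.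
  by rewrite ell2B basisE; case: eqVneq => [->|_]; rewrite ?subr0 // subr_ge0.
have -> : S (e_ i) - T (e_ i) = (S (e_ i) - trunc (S (e_ i)) M)
    + trunc (fun j => S (e_ i) j - T (e_ i) j) M.
  apply: ell2_ext => k; rewrite !ell2D !ell2N -TM !truncE; case: ifP => _.
    by rewrite addrN add0r.
  by rewrite oppr0 !addr0.
apply: (le_trans (norm2D_le _ _)); apply: lerD.
  apply: le_trans SUV; apply: norm2_dominated => k.
  rewrite !ell2B -VM !truncE; case: ifP => _; last by rewrite !subr0.
  by rewrite subrr Normc.normc0 normc_ge0.
apply: (le_trans (norm2_trunc_le_sum _ _)).
apply: (@le_trans _ _ (\sum_(0 <= k < M) d)).
  by apply: ler_sum_nat => k /andP[_ kM]; exact: head.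
by rewrite sumr_const_nat subn0 mulr_natl.
Qed.

End norm_attaining.

(** * Weakly open sets inside strong-star balls *)

Section weak_interior.
Variable R : realType.
Implicit Types (x y z u v : ell2 R) (T S : pos_contraction R).

Local Notation normc := (@Normc.normc R).
Local Notation e_ := (@ell2_basis R).

Definition is_compression T0 T1 m (a : R) : Prop :=
  forall x, T1 x = a%:C%C *: trunc (T0 (trunc x m)) m.

Lemma compression_exists T0 m (a : R) : 0 <= a -> a <= 1 ->
  exists T1, is_compression T0 T1 m a.
Proof.
move=> a0 a1.
have [|x x0|x|T1 T1E] := @pos_contraction_of R
    (fun x => a%:C%C *: trunc (T0 (trunc x m)) m).
- move=> c x y; rewrite truncD truncZ linearD linearZ_LR truncD truncZ scalerDr.
  by rewrite !scalerA mulrC.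
- apply: nonneg_vecZ; first by rewrite lecR.
  by apply: nonneg_trunc; apply: pos_contraction_pos; exact: nonneg_trunc.
- rewrite norm2_ell2Z normc_real // (le_trans (ler_piMl _ a1)) ?norm2_ge0 //.
  apply: (le_trans (trunc_le _ _)); apply: (le_trans (contraction _ _)).
  exact: trunc_le.
by exists T1.
Qed.

Section compression.
Variables (T0 T1 : pos_contraction R) (m : nat) (a : R).
Hypotheses (a0 : 0 <= a) (T1E : is_compression T0 T1 m a).

Lemma compression_adj : is_compression (adj T0) (adj T1) m a.
Proof.
move=> y; apply: dot_inj => x; rewrite -dot_adj T1E dotZl dotZr conjc_real.
by rewrite dot_trunc_sym dot_adj dot_trunc_sym.
Qed.

Lemma compression_norm x : norm2 (T1 x) <= a * norm2 x.
Proof.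
rewrite T1E norm2_ell2Z normc_real //; apply: ler_wpM2l => //.
apply: (le_trans (trunc_le _ _)); apply: (le_trans (contraction _ _)).
exact: trunc_le.
Qed.

Lemma compression_supp x : trunc (T1 x) m = T1 x.
Proof. by rewrite T1E truncZ trunc_trunc. Qed.

Lemma compression_trunc x : T1 (trunc x m) = T1 x.
Proof. by rewrite !T1E trunc_trunc. Qed.

End compression.

(** The same [m] and [a] serve [T0] and its adjoint, as the adjoint of a
    compression is the compression of the adjoint. *)
Lemma compression_close T0 n (e : R) M : 0 < e ->
  exists m a T1, [/\ (n <= m)%N, (M <= m)%N, 0 <= a, a < 1 &
    is_compression T0 T1 m a /\ sotball T0 n e T1].
Proof.
move=> e0.
have tails (S : pos_contraction R) : exists m, forall k i, (m <= k)%N -> (i < n)%N ->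
    norm2 (S (e_ i) - trunc (S (e_ i)) k) < e / 2.
  elim: n => [|n [m hm]]; first by exists 0%N.
  have [|m' hm'] := norm2_tail_small (S (e_ n)) (e := e / 2).
    by rewrite divr_gt0.
  exists (maxn m m') => k i; rewrite geq_max => /andP[mk m'k].
  by rewrite ltnS leq_eqVlt => /orP[/eqP ->|]; [exact: hm'|exact: hm].
have [m1 h1] := tails T0; have [m2 h2] := tails (adj T0).
pose m := maxn (maxn n M) (maxn m1 m2).
pose a := Num.max 0 (1 - e / 4).
have a0 : 0 <= a by rewrite le_max lexx.
have a1 : a < 1 by rewrite gt_max ltr01 gtrBl divr_gt0.
have ae : 1 - a <= e / 4 by rewrite lerBlDr -lerBlDl le_max lexx orbT.
have nm : (n <= m)%N by rewrite !leq_max leqnn.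
have Mm : (M <= m)%N by rewrite !leq_max leqnn orbT.
have [T1 T1E] := compression_exists T0 m a0 (ltW a1).
exists m, a, T1; split => //; split => //.
have close (S S1 : pos_contraction R) i : is_compression S S1 m a ->
    (i < n)%N -> norm2 (S (e_ i) - trunc (S (e_ i)) m) < e / 2 ->
    norm2 (S1 (e_ i) - S (e_ i)) < e.
  move=> S1E ni h; rewrite S1E trunc_basis ?(leq_trans ni) //.
  have -> : a%:C%C *: trunc (S (e_ i)) m - S (e_ i) =
      (a - 1)%:C%C *: trunc (S (e_ i)) m - (S (e_ i) - trunc (S (e_ i)) m).
    by rewrite rmorphB scalerBl scale1r opprB addrA subrK.
  apply: (le_lt_trans (norm2B_le _ _)).
  have : norm2 ((a - 1)%:C%C *: trunc (S (e_ i)) m) <= 1 - a.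
    have a1' : 0 <= 1 - a by rewrite subr_ge0 ltW.
    rewrite norm2_ell2Z -normcN -rmorphN opprB normc_real //.
    rewrite ler_piMr //.
    apply: (le_trans (trunc_le _ _)); apply: (le_trans (contraction _ _)).
    by rewrite norm2_basis.
  by lra.
move=> i ni; split.
  by apply: close T1E _ _ => //; apply: h1 => //; rewrite !leq_max leqnn !orbT.
apply: close (compression_adj T1E) _ _ => //.
by apply: h2 => //; rewrite !leq_max leqnn !orbT.
Qed.

Lemma nonneg_dist_le1 (b c : R[i]) : 0 <= b -> 0 <= c -> normc (b - c) <= 1 ->
  b <= c + 1.
Proof.
move=> /complex_ge0P + /complex_ge0P; case: b c => b1 b2 [c1 c2] /= [b0 ->] [c0 ->].
rewrite subrr expr0n /= addr0 sqrtr_sqr ler_norml => /andP[_ h].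
by rewrite lecE /= addr0 eqxx /= -lerBlDl.
Qed.

(** Iterate [u := 1 + T1^* v], [v := 1 + T1 u] from zero.  The increments decrease
    geometrically, so that in the end they are at most [1] in each coordinate;
    then [1 + T1 u <= v + 1], and likewise for [u]. *)
Lemma supersolution T0 T1 m (a : R) : 0 <= a -> a < 1 ->
  is_compression T0 T1 m a ->
  exists u v, [/\ nonneg_vec u, nonneg_vec v, trunc u m = u, trunc v m = v &
    [/\ forall i, (i < m)%N -> 1 <= u i, forall i, (i < m)%N -> 1 <= v i,
        nonneg_vec (v - T1 u) & nonneg_vec (u - adj T1 v)]].
Proof.
move=> a0 a1 T1E; have T1E' := compression_adj T1E.
pose one : ell2 R := trunc (fun=> 1) m.
have one_supp : trunc one m = one by exact: trunc_trunc.
have one0 : nonneg_vec one by move=> k; rewrite truncE; case: ifP.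
pose s := fix s k : ell2 R * ell2 R := if k is k'.+1
  then (one + adj T1 (s k').2, one + T1 (s k').1) else (0, 0).
have sS1 k : (s k.+1).1 = one + adj T1 (s k).2 by [].
have sS2 k : (s k.+1).2 = one + T1 (s k).1 by [].
have s0 k : nonneg_vec (s k).1 /\ nonneg_vec (s k).2.
  elim: k => [|k [IH1 IH2]]; first by split => i; rewrite ell20.
  by split; apply: nonneg_vecD => //; exact: pos_contraction_pos.
have ss k : trunc (s k).1 m = (s k).1 /\ trunc (s k).2 m = (s k).2.
  case: k => [|k]; last first.
    by rewrite sS1 sS2 !truncD (compression_supp T1E) (compression_supp T1E') one_supp.
  by split; apply: ell2_ext => i; rewrite truncE; case: ifP.
pose D k := norm2 ((s k.+1).1 - (s k).1) + norm2 ((s k.+1).2 - (s k).2).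
have DS k : D k.+1 <= a * D k.
  rewrite /D mulrDr addrC; apply: lerD.
    have -> : (s k.+2).2 - (s k.+1).2 = T1 ((s k.+1).1 - (s k).1).
      by rewrite !sS2 linearB opprD addrACA subrr add0r.
    exact: (compression_norm a0 T1E).
  have -> : (s k.+2).1 - (s k.+1).1 = adj T1 ((s k.+1).2 - (s k).2).
    by rewrite !sS1 linearB opprD addrACA subrr add0r.
  exact: (compression_norm a0 T1E').
have Da k : D k <= a ^+ k * D 0%N.
  elim: k => [|k IHk]; first by rewrite expr0 mul1r.
  by apply: (le_trans (DS k)); rewrite exprS -mulrA; exact: ler_wpM2l.
have [k Dk] : exists k, D k.+1 <= 1.
  have : (fun k => a ^+ k * D 0%N) @ \oo --> (0 : R).
    rewrite -[X in _ --> X](mul0r (D 0%N)); apply: cvgMl.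
    by apply: cvg_expr; rewrite ger0_norm.
  move=> /cvgrPdist_le /(_ 1 ltr01) [k _ /(_ k.+1 (leqnSn k))] /= h.
  exists k; apply: (le_trans (Da k.+1)); apply: le_trans h.
  by rewrite sub0r normrN; exact: ler_norm.
have [u0 v0] := s0 k.+1; have [us vs] := ss k.+1.
have [u0' v0'] := s0 k.+2.
have D1 : norm2 ((s k.+2).1 - (s k.+1).1) <= 1.
  by apply: le_trans Dk; rewrite lerDl norm2_ge0.
have D2 : norm2 ((s k.+2).2 - (s k.+1).2) <= 1.
  by apply: le_trans Dk; rewrite lerDr norm2_ge0.
have oneE i : (i < m)%N -> one i = 1 by move=> im; rewrite truncE im.
have ge1 x i : nonneg_vec x -> (i < m)%N -> 1 <= (one + x) i.
  by move=> x0 im; rewrite ell2D oneE // lerDl.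
have super x z : nonneg_vec (one + x) -> nonneg_vec z -> trunc x m = x ->
    trunc z m = z -> norm2 ((one + x) - z) <= 1 -> nonneg_vec (z - x).
  move=> x0 z0 xm zm xz i; rewrite ell2B subr_ge0.
  have [im|mi] := ltnP i m; last by rewrite -xm -zm !truncE ltnNge mi.
  have := @nonneg_dist_le1 ((one + x) i) (z i) (x0 i) (z0 i).
  rewrite -ell2B => /(_ (le_trans (normc_coord _ _) xz)).
  by rewrite ell2D oneE // addrC lerD2r.
exists (s k.+1).1, (s k.+1).2; split => //; split.
- by move=> i; apply: ge1; apply: pos_contraction_pos; have [] := s0 k.
- by move=> i; apply: ge1; apply: pos_contraction_pos; have [] := s0 k.
- by apply: super => //; rewrite (compression_supp T1E).
- by apply: super => //; rewrite (compression_supp T1E').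
Qed.

End weak_interior.

Section bordering.
Variable R : realType.
Implicit Types (x y z u v E F : ell2 R) (T S : pos_contraction R) (s K : R).

Local Notation normc := (@Normc.normc R).
Local Notation e_ := (@ell2_basis R).

(** The operator [T] on the first [m] coordinates, bordered by a column [E], a
    row [F] and a corner entry [s] in position [m]. *)
Definition border T m (E F : ell2 R) (s : R) z : ell2 R :=
  T z + z m *: E + (dot z F + s%:C%C * z m) *: e_ m.

Lemma border_linear T m E F s (a : R[i]) x y :
  border T m E F s (a *: x + y) = a *: border T m E F s x + border T m E F s y.
Proof.
apply: ell2_ext => k; rewrite /border linearD linearZ_LR dotDZl.
by rewrite !(ell2D, ell2Z); ring.
Qed.

Lemma border_pos T m E F s : nonneg_vec E -> nonneg_vec F -> 0 <= s ->
  positive_op (border T m E F s).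
Proof.
move=> E0 F0 s0 z z0; apply: nonneg_vecD; first apply: nonneg_vecD.
- exact: pos_contraction_pos.
- exact: nonneg_vecZ.
- apply: nonneg_vecZ; last exact: basis_ge0.
  by rewrite addr_ge0 ?dot_ge0 // mulr_ge0 // lecR.
Qed.

Lemma border_adj T m E F s x y :
  dot (border T m E F s x) y = dot x (border (adj T) m F E s y).
Proof.
rewrite /border !dotDl !dotDr !dotZl !dotZr dot_adj dot_basisl dot_basisr.
have -> : conjc (dot y E + s%:C%C * y m) = dot E y + s%:C%C * conjc (y m).
  rewrite rmorphD rmorphM [dot E y]dotC; congr (_ + _ * _).
  exact: conjc_real.
by ring.
Qed.

Lemma border_image T m E F s u v (K K' : R) : trunc u m = u -> trunc F m = F ->
  (forall x, T (trunc x m) = T x) -> K%:C%C *: E = v - T u ->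
  dot u F + (s * K)%:C%C = K'%:C%C ->
  border T m E F s (u + K%:C%C *: e_ m) = v + K'%:C%C *: e_ m.
Proof.
move=> um Fm Tm KE sK.
have Um : (u + K%:C%C *: e_ m) m = K%:C%C.
  by rewrite ell2D ell2Z basisE eqxx mulr1 -um truncE ltnn add0r.
have FU : dot (u + K%:C%C *: e_ m) F = dot u F.
  by rewrite dotDl dotZl dot_basisl -Fm truncE ltnn conjc0 mulr0 addr0.
have TU : T (u + K%:C%C *: e_ m) = T u.
  by rewrite -[LHS]Tm truncD truncZ trunc_basis0 // scaler0 addr0 Tm.
rewrite /border Um FU TU KE -rmorphM sK; congr (_ + _).
by rewrite addrC subrK.
Qed.

Lemma norm2_orth_sum u m (K : R) : trunc u m = u ->
  norm2 (u + K%:C%C *: e_ m) ^+ 2 = norm2 u ^+ 2 + K ^+ 2.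
Proof.
move=> um; rewrite (norm2_split _ m) truncD truncZ trunc_basis0 // scaler0 addr0.
by rewrite um addrAC subrr add0r norm2_ell2Z norm2_basis mulr1 normc_sq_real.
Qed.

(** Take a strict compression [T1] near [T0] with supersolutions [u], [v], and
    border it by [E = (v - T1 u) / K], [F = (u - T1^* v) / K'] and a corner [s].
    The bordered operator maps [U = u + K e_m] to [V = v + K' e_m] and its adjoint
    maps [V] back to [U], provided that [s] satisfies two equations; these agree
    as soon as [K^2 - |v|^2 = K'^2 - |u|^2].  Schur's test bounds its norm, and for
    large [K] and [K'] the borders [E] and [F] are small.  The corner does not
    matter for closeness, since it acts beyond the coordinates under control. *)
Lemma norm_attaining_dense T0 n (e : R) : 0 < e ->
  exists T U V M, [/\ sotball T0 n e T, T U = V, adj T V = U, (n <= M)%N &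
   [/\ nonneg_vec U, nonneg_vec V, (forall i, (i < n)%N -> 1 <= U i),
      (forall i, (i < n)%N -> 1 <= V i) &
   [/\ norm2 V = norm2 U, trunc U M = U, trunc V M = V,
      forall x, trunc (T x) M = T x & forall x, trunc (adj T x) M = adj T x]]].
Proof.
move=> e0; have e2 : 0 < e / 2 by rewrite divr_gt0.
have [m [a [T1 [nm _ a0 a1 [T1E T1b]]]]] := compression_close T0 n 0 e2.
have T1E' := compression_adj T1E.
have [u [v [u0 v0 um vm [u1 v1 Ev Fu]]]] := supersolution a0 a1 T1E.
set Ex := v - T1 u in Ev; set Fx := u - adj T1 v in Fu.
(* [L] is a lower bound for [K] and [K'] that makes both borders shorter than
   [e / 2]. *)
pose L := 1 + (norm2 Ex + norm2 Fx) / (e / 2).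
have L1 : 1 <= L by rewrite lerDl divr_ge0 ?addr_ge0 ?norm2_ge0 // ltW.
have L0 : 0 < L := lt_le_trans ltr01 L1.
pose K := Num.sqrt (L ^+ 2 + norm2 v ^+ 2).
pose K' := Num.sqrt (L ^+ 2 + norm2 u ^+ 2).
have K2 : K ^+ 2 = L ^+ 2 + norm2 v ^+ 2 by rewrite sqr_sqrtr // addr_ge0 ?sqr_ge0.
have K'2 : K' ^+ 2 = L ^+ 2 + norm2 u ^+ 2 by rewrite sqr_sqrtr // addr_ge0 ?sqr_ge0.
have LK : L <= K.
  by rewrite -(ger0_norm (ltW L0)) -sqrtr_sqr ler_wsqrtr // lerDl sqr_ge0.
have LK' : L <= K'.
  by rewrite -(ger0_norm (ltW L0)) -sqrtr_sqr ler_wsqrtr // lerDl sqr_ge0.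
clearbody K K'.
have K0 : 0 < K := lt_le_trans L0 LK.
have K'0 : 0 < K' := lt_le_trans L0 LK'.
pose p := normc (dot (T1 u) v).
have pE : dot (T1 u) v = p%:C%C.
  by apply: nonneg_normc; apply: dot_ge0 => //; exact: pos_contraction_pos.
have pE' : dot (adj T1 v) u = p%:C%C.
  by rewrite dotC -dot_adj pE conjc_real.
pose s := (L ^+ 2 + p) / (K * K').
have s0 : 0 <= s.
  by rewrite divr_ge0 ?addr_ge0 ?sqr_ge0 ?normc_ge0 // mulr_ge0 // ltW.
pose E := K^-1%:C%C *: Ex; pose F := K'^-1%:C%C *: Fx.
have E0 : nonneg_vec E by apply: nonneg_vecZ => //; rewrite lecR invr_ge0 ltW.
have F0 : nonneg_vec F by apply: nonneg_vecZ => //; rewrite lecR invr_ge0 ltW.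
have scaleK (k : R) (x : ell2 R) : 0 < k -> k%:C%C *: (k^-1%:C%C *: x) = x.
  by move=> k0; rewrite scalerA -rmorphM mulfV ?gt_eqF // scale1r.
have Exm : trunc Ex m = Ex.
  by rewrite /Ex -scaleN1r truncD vm truncZ (compression_supp T1E).
have Fxm : trunc Fx m = Fx.
  by rewrite /Fx -scaleN1r truncD um truncZ (compression_supp T1E').
have Em : trunc E m = E by rewrite truncZ Exm.
have Fm : trunc F m = F by rewrite truncZ Fxm.
pose U := u + K%:C%C *: e_ m; pose V := v + K'%:C%C *: e_ m.
have dotuF : dot u F = ((norm2 u ^+ 2 - p) / K')%:C%C.
  rewrite dotZr dotBr dotxx -dot_adj pE -rmorphB mulrC.
  by rewrite (_ : conjc K'^-1%:C%C = K'^-1%:C%C) ?conjc_real // -rmorphM.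
have dotvE : dot v E = ((norm2 v ^+ 2 - p) / K)%:C%C.
  rewrite dotZr dotBr dotxx -[T1]adjK -dot_adj pE' -rmorphB mulrC.
  by rewrite (_ : conjc K^-1%:C%C = K^-1%:C%C) ?conjc_real // -rmorphM.
have fU : border T1 m E F s U = V.
  apply: border_image => //.
  - exact: compression_trunc T1E.
  - exact: scaleK.
  rewrite dotuF -rmorphD; congr (_%:C%C).
  rewrite /s (_ : norm2 u ^+ 2 = K' ^+ 2 - L ^+ 2); last by rewrite K'2; ring.
  by field; rewrite !gt_eqF.
have gV : border (adj T1) m F E s V = U.
  apply: border_image => //.
  - exact: compression_trunc T1E'.
  - exact: scaleK.
  rewrite dotvE -rmorphD; congr (_%:C%C).
  rewrite /s (_ : norm2 v ^+ 2 = K ^+ 2 - L ^+ 2); last by rewrite K2; ring.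
  by field; rewrite !gt_eqF.
have posU (x : ell2 R) (k : R) : nonneg_vec x -> 0 <= k -> nonneg_vec (x + k%:C%C *: e_ m).
  move=> x0 k0; apply: nonneg_vecD => //; apply: nonneg_vecZ; last exact: basis_ge0.
  by rewrite lecR.
have U0 : nonneg_vec U by apply: posU => //; exact: ltW.
have V0 : nonneg_vec V by apply: posU => //; exact: ltW.
have supp (x : ell2 R) (k : R[i]) : trunc x m = x ->
    trunc (x + k *: e_ m : ell2 R) m.+1 = x + k *: e_ m.
  by move=> xm; rewrite truncD truncZ trunc_basis // (trunc_id (leqnSn m) xm).
have bsupp S (E' F' z : ell2 R) : trunc E' m = E' -> trunc (S z) m = S z ->
    trunc (border S m E' F' s z) m.+1 = border S m E' F' s z.
  move=> E'm Sz; apply: supp.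
  by rewrite truncD truncZ E'm Sz.
have low (x : ell2 R) (k : R) i : (i < m)%N -> (x + k%:C%C *: e_ m) i = x i.
  move=> im; have ei : e_ m i = 0 by rewrite basisE ltn_eqF.
  by rewrite ell2D ell2Z ei mulr0 addr0.
have Upos j : (j < m.+1)%N -> 0 < U j.
  rewrite ltnS leq_eqVlt => /orP[/eqP ->|jm].
    rewrite ell2D -um truncE ltnn add0r ell2Z basisE eqxx mulr1.
    by rewrite ltcR.
  by rewrite (low u K) //; exact: lt_le_trans (u1 j jm).
have fM x : border T1 m E F s x = border T1 m E F s (trunc x m.+1).
  rewrite /border truncE ltnSn -[T1 x](compression_trunc T1E).
  rewrite -[T1 (trunc x m.+1)](compression_trunc T1E).
  have -> : trunc (trunc x m.+1) m = trunc x m.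
    apply: ell2_ext => k; rewrite !truncE; case: ifP => // km.
    by rewrite ltnS ltnW.
  by rewrite dot_trunc_sym (trunc_id (leqnSn m) Fm).
have fn := Schur_test (@border_linear T1 m E F s) (border_pos T1 m E0 F0 s0)
  (@border_adj T1 m E F s) V0 Upos U0 fU gV fM.
have [T TE] := pos_contraction_of (@border_linear T1 m E F s)
  (border_pos T1 m E0 F0 s0) fn.
have TE' y : adj T y = border (adj T1) m F E s y.
  by rewrite adjE; apply: adjointE => x z; rewrite TE border_adj.
have closeT (S S1 : pos_contraction R) (G H : ell2 R) i :
    (forall x, S x = border S1 m G H s x) ->
    (i < n)%N -> trunc G m = G -> norm2 H < e / 2 -> norm2 (S (e_ i) - S1 (e_ i)) < e / 2.
  move=> SE ni Gm He; rewrite SE /border dot_basisl.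
  have -> : e_ i m = 0 by rewrite basisE gtn_eqF // (leq_trans ni).
  rewrite scale0r addr0 mulr0 addr0 addrC addKr norm2_ell2Z norm2_basis mulr1.
  by rewrite Defs.normcJ; apply: le_lt_trans He; exact: normc_coord.
have small (k : R) (x : ell2 R) : L <= k -> norm2 x <= norm2 Ex + norm2 Fx ->
    norm2 (k^-1%:C%C *: x) < e / 2.
  move=> Lk xEF; have k0 : 0 < k := lt_le_trans L0 Lk.
  rewrite norm2_ell2Z normc_real ?invr_ge0 ?(ltW k0) // ltr_pdivrMl //.
  apply: (le_lt_trans xEF); rewrite -ltr_pdivrMr //.
  by apply: lt_le_trans Lk; rewrite /L ltrDr.
have VU : norm2 V = norm2 U.
  have VU2 : norm2 V ^+ 2 = norm2 U ^+ 2.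
    have VN : norm2 V ^+ 2 = norm2 v ^+ 2 + K' ^+ 2 := norm2_orth_sum K' vm.
    have UN : norm2 U ^+ 2 = norm2 u ^+ 2 + K ^+ 2 := norm2_orth_sum K um.
    rewrite VN UN K2 K'2; move: (norm2 u ^+ 2) (norm2 v ^+ 2) (L ^+ 2).
    by move=> b c l; ring.
  move: VU2 (norm2_ge0 V) (norm2_ge0 U); move: (norm2 V) (norm2 U) => b c.
  by move=> /eqP bc b0 c0; move: bc; rewrite eqrXn2 // => /eqP.
exists T, U, V, m.+1; split.
- move=> i ni; have [h1 h2] := T1b i ni; split.
    apply: (le_lt_trans (norm2_triangle (T1 (e_ i)) _ _)).
    rewrite [e]splitr; apply: ltrD; last exact: h1.
    apply: (closeT T T1 E F i TE ni Em); apply: small; first exact: LK'.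
    by rewrite lerDr norm2_ge0.
  apply: (le_lt_trans (norm2_triangle (adj T1 (e_ i)) _ _)).
  rewrite [e]splitr; apply: ltrD; last exact: h2.
  apply: (closeT (adj T) (adj T1) F E i TE' ni Fm); apply: small; first exact: LK.
  by rewrite lerDl norm2_ge0.
- by rewrite TE fU.
- by rewrite TE' gV.
- exact: (leq_trans nm).
split; [exact: U0|exact: V0| | |].
- move=> i ni; have im := leq_trans ni nm.
  have -> : U i = u i by exact: low.
  exact: u1.
- move=> i ni; have im := leq_trans ni nm.
  have -> : V i = v i by exact: low.
  exact: v1.
split.
- exact: VU.
- exact: supp.
- exact: supp.
- by move=> x; rewrite TE; apply: (bsupp T1 E F x Em); exact: compression_supp T1E _.
- by move=> x; rewrite TE'; apply: (bsupp (adj T1) F E x Fm); exact: compression_supp T1E' _.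
Qed.

(** A weak neighbourhood of a nearby norm attaining contraction: closeness of the
    adjoints follows by exchanging the roles of [U] and [V]. *)
Lemma WOT_open_in_sotball T0 n (e : R) : 0 < e ->
  exists W : set (pos_contraction R),
    [/\ @open (WOT R) W, W !=set0 & W `<=` sotball T0 n e].
Proof.
move=> e0; have e2 : 0 < e / 2 by rewrite divr_gt0.
have [T [U [V [M [Tb TU TV nM [U0 V0 U1 V1 [VU UM VM TM TM']]]]]]] :=
  norm_attaining_dense T0 n e2.
pose g := e / 4; have g0 : 0 < g by rewrite divr_gt0.
pose d := e / 4 / M.+1%:R; have d0 : 0 < d by rewrite divr_gt0.
have Md : M%:R * d <= e / 4.
  rewrite /d mulrCA; apply: ler_piMr; first exact: ltW.
  by rewrite ler_pdivrMr // mul1r ler_nat.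
have g2 : 0 < g ^+ 2 / 2 by rewrite divr_gt0 // exprn_gt0.
pose W := [set S : pos_contraction R | normc (dot (S U) V - (norm2 U ^+ 2)%:C%C) < g ^+ 2 / 2]
  `&` [set S : pos_contraction R | forall i j : 'I_M,
         normc (dot (S (e_ i)) (e_ j) - T (e_ i) j) < d].
exists W; split.
- apply: (@openI (WOT R)); first exact: WOT_coef_open.
  rewrite openE => S hS.
  have nb (i j : 'I_M) : @nbhs _ (WOT R) S [set S' : pos_contraction R |
      normc (dot (S' (e_ i)) (e_ j) - T (e_ i) j) < d].
    by apply: open_nbhs_nbhs; split; [exact: WOT_coef_open|exact: hS].
  exact: (filter_forall _ (fun i => filter_forall _ (nb i))).
- exists T; split => /=.
    by rewrite TU dotxx VU subrr Normc.normc0.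
  by move=> i j; rewrite dot_basisr subrr Normc.normc0.
move=> S [SU Sc] i ni; have iM : (i < M)%N := leq_trans ni nM.
have [Tb1 Tb2] := Tb i ni.
have close (S' T' : pos_contraction R) (A B : ell2 R) :
    nonneg_vec A -> 1 <= A i -> norm2 B = norm2 A -> trunc B M = B ->
    trunc (T' (e_ i)) M = T' (e_ i) ->
    normc (dot (S' A) B - (norm2 A ^+ 2)%:C%C) < g ^+ 2 / 2 ->
    (forall j : 'I_M, normc (S' (e_ i) j - T' (e_ i) j) < d) ->
    norm2 (S' (e_ i) - T' (e_ i)) <= e / 2.
  move=> A0 A1 BA BM T'M S'A S'c.
  apply: (le_trans (norm_attaining_close A0 A1 BA BM T'M (ltW g0) (ltW S'A) _)).
    by move=> j jM; apply: ltW; exact: (S'c (Ordinal jM)).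
  by rewrite /g; lra.
split.
  apply: (le_lt_trans (norm2_triangle (T (e_ i)) _ _)).
  rewrite [e]splitr; apply: ler_ltD; last exact: Tb1.
  apply: (close S T U V) => //; first exact: U1.
  by move=> j; have := Sc (Ordinal iM) j; rewrite dot_basisr.
apply: (le_lt_trans (norm2_triangle (adj T (e_ i)) _ _)).
rewrite [e]splitr; apply: ler_ltD; last exact: Tb2.
apply: (close (adj S) (adj T) V U) => //; first exact: V1.
  rewrite [dot _ _]dotC -dot_adj -(conjc_real (norm2 V ^+ 2)) -rmorphB.
  by rewrite [normc (conjc _)]Defs.normcJ VU.
move=> j; rewrite !adjE !adjoint_basis -rmorphB [normc (conjc _)]Defs.normcJ.
by have := Sc j (Ordinal iM); rewrite dot_basisr.
Qed.

End bordering.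

(** * Extending an approximate solution *)

Section extension.
Variable R : realType.
Implicit Types (x y z u v w : ell2 R) (T S : pos_contraction R).

Local Notation normc := (@Normc.normc R).
Local Notation e_ := (@ell2_basis R).

Lemma tail_shift_bound m z n :
  series (sq_norms (fun k => if (m <= k)%N then z k.+1 else 0)) n <=
  norm2 (z - trunc z m) ^+ 2.
Proof.
set y := z - trunc z m.
have yE k : (m <= k)%N -> y k.+1 = z k.+1.
  by move=> mk; rewrite ell2B truncE ltnNge (leq_trans mk) // subr0.
clearbody y; apply: le_trans (series_le_norm2 n.+1 (@ell2_summable R y)).
rewrite /series /= big_nat_recl //; apply: ler_wpDl; first exact: sq_norms_ge0.
apply: ler_sum => k _; rewrite /sq_norms; case: ifP => mk; first by rewrite yE.
by rewrite Normc.normc0 expr0n /= sqr_ge0.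
Qed.

Fact tail_shift_summable m z :
  (fun k => if (m <= k)%N then z k.+1 else 0) \in @square_summableb R.
Proof. by apply/asboolP; exact: square_summable_bounded (tail_shift_bound m z). Qed.

(** The backward shift on the coordinates from [m] on. *)
Definition tail_shift m z : ell2 R := Ell2 (tail_shift_summable m z).

Lemma tail_shiftE m z k : tail_shift m z k = if (m <= k)%N then z k.+1 else 0.
Proof. by []. Qed.

Lemma tail_shift_le m z : norm2 (tail_shift m z) <= norm2 (z - trunc z m).
Proof. by apply: norm2_le => [|n]; [exact: norm2_ge0|exact: tail_shift_bound]. Qed.

Lemma trunc_tail_shift m z : trunc (tail_shift m z) m = 0.
Proof.
by apply: ell2_ext => k; rewrite truncE tail_shiftE; case: ltnP.
Qed.

Section step.
Variables (T0 T1 : pos_contraction R) (m : nat) (a : R).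
Hypotheses (a0 : 0 <= a) (a1 : a <= 1) (T1E : is_compression T0 T1 m a).

Lemma shift_extension_exists :
  {T : pos_contraction R | forall z, T z = T1 z + tail_shift m z}.
Proof.
apply: pos_contraction_of => [c x y|z z0|z].
- rewrite linearD linearZ_LR scalerDr addrACA; congr (_ + _).
  apply: ell2_ext => k; rewrite ell2D ell2Z !tail_shiftE.
  by case: ifP => _; rewrite ?ell2D ?ell2Z // mulr0 addr0.
- apply: nonneg_vecD; first exact: pos_contraction_pos.
  by move=> k; rewrite tail_shiftE; case: ifP.
- rewrite -[leLHS]ger0_norm ?norm2_ge0 // -[leRHS]ger0_norm ?norm2_ge0 //.
  rewrite -!sqrtr_sqr ler_wsqrtr // (norm2_split _ m) (norm2_split z m).
  have -> : trunc (T1 z + tail_shift m z) m = T1 z.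
    by rewrite truncD trunc_tail_shift addr0 (compression_supp T1E).
  have -> : T1 z + tail_shift m z - T1 z = tail_shift m z.
    by rewrite addrAC subrr add0r.
  apply: lerD; rewrite ler_sqr ?nnegrE ?norm2_ge0 //; last exact: tail_shift_le.
  by rewrite -[T1 z](compression_trunc T1E) contraction.
Qed.

Variable T : pos_contraction R.
Hypothesis TE : forall z, T z = T1 z + tail_shift m z.

Lemma shift_ext_low z : trunc z m = z -> T z = T1 z.
Proof.
move=> zm; rewrite TE -[RHS]addr0; congr (_ + _); apply: ell2_ext => k.
rewrite tail_shiftE ell20; case: ifP => // mk.
by rewrite -zm truncE ltnNge (leq_trans mk).
Qed.

Lemma shift_ext_high z : trunc z m = 0 -> T z = tail_shift m z.
Proof.
move=> zm; rewrite TE -[T1 z](compression_trunc T1E) zm.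
by rewrite (linear0 T1) add0r.
Qed.

Lemma shift_ext_basis : T (e_ m) = 0.
Proof.
rewrite shift_ext_high; last exact: trunc_basis0.
apply: ell2_ext => k; rewrite tail_shiftE basisE ell20; case: ifP => // mk.
by rewrite gtn_eqF // ltnS.
Qed.

Lemma iter_low n z : trunc z m = z ->
  trunc (iter n T z) m = iter n T z /\ norm2 (iter n T z) <= a ^+ n * norm2 z.
Proof.
move=> zm; elim: n => [|n [IH1 IH2]]; first by rewrite expr0 mul1r.
rewrite iterS (shift_ext_low IH1) (compression_supp T1E); split => //.
apply: (le_trans (compression_norm a0 T1E _)).
by rewrite exprS -mulrA; exact: ler_wpM2l.
Qed.

Lemma iter_high n z : trunc z m = 0 ->
  trunc (iter n T z) m = 0 /\ forall j, iter n T z (m + j)%N = z (m + j + n)%N.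
Proof.
move=> zm; elim: n => [|n [IH1 IH2]]; first by split=> // j; rewrite addn0.
rewrite iterS (shift_ext_high IH1) trunc_tail_shift; split => // j.
by rewrite tail_shiftE leq_addr -addnS IH2 addnS addSnnS.
Qed.

Lemma shift_sotball n (e : R) : (n <= m)%N ->
  sotball T0 n e T1 -> sotball T0 n e T.
Proof.
move=> nm h i ni; have im := leq_trans ni nm.
have ei := trunc_basis R im.
rewrite (shift_ext_low ei).
have -> : adj T (e_ i) = adj T1 (e_ i).
  apply: ell2_ext => j; rewrite !adjE !adjoint_basis TE ell2D tail_shiftE.
  by rewrite leqNgt im addr0.
exact: h.
Qed.

(** Adding [eta e_m] to [w] pairs with the coordinate [m], to which the shift
    brings the coordinates of [u] one after the other; they are chosen so as to
    cancel the defects of [x] and [w]. *)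
Lemma cancel_defects x w (eta : R) N : 0 < eta ->
  trunc x m = x -> trunc w m = w ->
  (forall M, \sum_(1 <= n < M.+1) normc (defect T (iter n T x) w) ^+ 2
     <= eta ^+ 4) ->
  exists u, norm2 u <= eta /\
    residual T (x + u) (w + eta%:C%C *: e_ m) N
      <= (a ^+ N.+1 * norm2 x * (norm2 w + eta)) ^+ 2.
Proof.
move=> eta0 xm wm small.
pose c n := defect T (iter n T x) w.
(* The coordinate [m] of [u] stays zero, as the defect for [n = 0] must
   not be cancelled. *)
pose f k := if (m < k)%N then - (eta^-1)%:C%C * c (k - m)%N else 0.
pose u := trunc f (m + N).+1.
have um : trunc u m = 0.
  apply: ell2_ext => k; rewrite !truncE /f ell20; case: ifP => // km.
  by rewrite [(m < k)%N]ltnNge (ltnW km) /=; case: ifP.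
exists u; split.
  rewrite -[leLHS]ger0_norm ?norm2_ge0 // -[leRHS]ger0_norm ?(ltW eta0) //.
  rewrite -!sqrtr_sqr ler_wsqrtr // norm2_truncE.
  rewrite (big_cat_nat (n := m.+1)) //=; last by rewrite ltnS leq_addr.
  rewrite big_nat_cond big1 ?add0r; last first.
    move=> k /andP[/andP[_ km] _].
    by rewrite /f ltnNge -ltnS km Normc.normc0 expr0n.
  rewrite -add1n big_addn subSn ?leq_addr // addKn.
  apply: (@le_trans _ _ (eta ^- 2 * \sum_(1 <= n < N.+1) normc (c n) ^+ 2)).
    rewrite mulr_sumr le_eqVlt; apply/orP; left; apply/eqP.
    apply: eq_big_nat => k /andP[k0 _].
    rewrite /f addnK -{1}[m]add0n ltn_add2r k0 Normc.normcM normcN.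
    by rewrite normc_real ?invr_ge0 ?(ltW eta0) // exprMn exprVn.
  apply: (@le_trans _ _ (eta ^- 2 * eta ^+ 4)).
    by apply: ler_wpM2l => //; rewrite invr_ge0 sqr_ge0.
  by rewrite le_eqVlt; apply/orP; left; apply/eqP; field; rewrite gt_eqF.
rewrite /residual iterD.
have -> : iter N.+1 T u = 0.
  have [h1 h2] := iter_high N.+1 um; apply: ell2_ext => k; rewrite ell20.
  have [km|mk] := ltnP k m.
    by have := congr1 (fun x : ell2 R => x k) h1; rewrite truncE km ell20.
  rewrite -(subnKC mk) h2 truncE ltnNge.
  by rewrite addnS ltnS leq_add2r leq_addr.
rewrite addr0.
have -> : \sum_(1 <= n < N.+1)
    normc (defect T (iter n T (x + u)) (w + eta%:C%C *: e_ m)) ^+ 2 = 0.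
  rewrite big_nat_cond big1 // => n /andP[/andP[n0 nN] _].
  have [z1 _] := iter_low n xm; have [y1 y2] := iter_high n um.
  have -> : defect T (iter n T (x + u)) (w + eta%:C%C *: e_ m) = 0.
    rewrite iterD defectDl !defectDr !defectZr -/(c n) conjc_real.
    have -> : defect T (iter n T x) (e_ m) = 0.
      by rewrite /defect shift_ext_basis dot0r dot_basisr -z1 truncE ltnn subr0.
    have -> : defect T (iter n T u) w = 0.
      rewrite /defect (shift_ext_low wm) (shift_ext_high y1).
      rewrite -[w in dot _ w]wm -dot_trunc_sym y1 dot0l.
      rewrite -(compression_supp T1E) -dot_trunc_sym trunc_tail_shift dot0l.
      by rewrite subrr.
    have -> : defect T (iter n T u) (e_ m) = - (eta^-1)%:C%C * c n.
      rewrite /defect shift_ext_basis dot0r dot_basisr subr0.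
      have := y2 0%N; rewrite addn0 => ->.
      by rewrite truncE ltnS leq_add2l -ltnS nN /f -{1}[m]addn0 ltn_add2l n0 addKn.
    rewrite mulr0 addr0 add0r mulNr mulrN mulrA -rmorphM mulfV ?gt_eqF //.
    by rewrite mul1r subrr.
  by rewrite Normc.normc0 expr0n.
rewrite add0r ler_sqr ?nnegrE ?mulr_ge0 ?norm2_ge0 ?exprn_ge0 ?addr_ge0 ?norm2_ge0 ?(ltW eta0) //.
apply: ler_pM; rewrite ?norm2_ge0 //; first exact: (iter_low N.+1 xm).2.
apply: (le_trans (norm2D_le _ _)); rewrite norm2_ell2Z norm2_basis mulr1.
by rewrite normc_real // ltW.
Qed.

End step.

(** The residual of the corrected vectors consists of its tail term only, which
    the strict compression [T1] makes small when [N'] is large. *)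
Lemma extension_step T0 x w M N n (e eta eps : R) :
  trunc x M = x -> trunc w M = w -> 0 < e -> 0 < eta -> 0 < eps ->
  (forall T, sotball T0 n e T -> residual T x w N < eta ^+ 4) ->
  exists T x' w' N', [/\ sotball T0 n e T, residual T x' w' N' < eps,
    norm2 (x' - x) <= eta & norm2 (w' - w) <= eta].
Proof.
move=> xM wM e0 eta0 eps0 good.
have [m [a [T1 [nm Mm a0 a1 [T1E T1b]]]]] := compression_close T0 n M e0.
have [T TE] := shift_extension_exists T1E.
have Tb := shift_sotball TE nm T1b.
have xm := trunc_id Mm xM; have wm := trunc_id Mm wM.
have [N' N'eps] : exists N', (a ^+ N'.+1 * norm2 x * (norm2 w + eta)) ^+ 2 < eps.
  pose k := norm2 x * (norm2 w + eta).
  have ak : (fun N' => a ^+ N' * k) @ \oo --> (0 : R).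
    rewrite -[X in _ --> X](mul0r k); apply: cvgMl.
    by apply: cvg_expr; rewrite ger0_norm.
  have ak2 : (fun N' => (a ^+ N' * k) ^+ 2) @ \oo --> (0 : R).
    by rewrite -[X in _ --> X](expr0n R 2); exact: cvg_sqr ak.
  move/cvgrPdist_lt : ak2 => /(_ eps eps0) [N' _ /(_ N'.+1 (leqnSn N'))] /= h.
  exists N'; apply: le_lt_trans h; rewrite sub0r normrN.
  by rewrite -mulrA; exact: ler_norm.
have small K : \sum_(1 <= i < K.+1) normc (defect T (iter i T x) w) ^+ 2 <= eta ^+ 4.
  by apply: (le_trans (sum_defect_residual T x w N K)); apply: ltW; exact: good.
have [u [u_le res]] := cancel_defects a0 T1E TE N' eta0 xm wm small.
exists T, (x + u), (w + eta%:C%C *: e_ m), N'; split => //.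
- exact: le_lt_trans res N'eps.
- by rewrite addrAC subrr add0r.
- by rewrite addrAC subrr add0r norm2_ell2Z norm2_basis mulr1 normc_real // ltW.
Qed.

(** Initial vectors of the chains: if [T e_m = 0] then [x = w = e_m] has zero
    defects for [n >= 1], and defect [1] for [n = 0]. *)
Lemma start_step T0 n (e : R) : 0 < e ->
  exists T m, sotball T0 n e T /\ T (e_ m) = 0.
Proof.
move=> e0; have [m [a [T1 [nm _ a0 a1 [T1E T1b]]]]] := compression_close T0 n 0 e0.
have [T TE] := shift_extension_exists T1E.
exists T, m; split; first exact: (shift_sotball TE nm T1b).
exact: (shift_ext_basis T1E TE).
Qed.

End extension.

(** * From a limit of approximate solutions to an invariant subspace *)

Section invariant.
Variable R : realType.
Implicit Types (x y z u v w : ell2 R) (T : pos_contraction R).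

Local Notation normc := (@Normc.normc R).
Local Notation e_ := (@ell2_basis R).

Lemma normc_defect T y z : normc (defect T y z) <= 2 * norm2 y * norm2 z.
Proof.
apply: (le_trans (le_normcD _ _)); rewrite normcN -mulrA mulrDl mul1r.
apply: lerD; first exact: dot_CauchySchwarz.
apply: (le_trans (dot_CauchySchwarz _ _)).
by apply: ler_pM; rewrite ?norm2_ge0 ?contraction.
Qed.

Lemma closed_zero_set (f : ell2 R -> R[i]) (c : R) :
  (forall y z, normc (f y - f z) <= c * norm2 (y - z)) ->
  closed [set z | f z = 0].
Proof.
move=> fc z /= clz; apply: Normc.eq0_normc; apply/eqP/negPn/negP => fz0.
have fz : 0 < normc (f z) by rewrite lt_neqAle eq_sym fz0 normc_ge0.
have c0 : 0 < `|c| + 1 by rewrite ltr_wpDl.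
have r0 : 0 < normc (f z) / (`|c| + 1) by rewrite divr_gt0.
have rC0 : 0 < (normc (f z) / (`|c| + 1))%:C%C :> R[i] by rewrite ltcR.
have [y [/= fy]] := clz _ (nbhsx_ballx z _ rC0).
rewrite -ball_normE /ball_ /= ell2_normE ltcR ltr_pdivlMr // => zy.
have := fc z y; rewrite fy subr0 => h.
have : normc (f z) < normc (f z).
  apply: (le_lt_trans h); apply: le_lt_trans zy.
  rewrite mulrC; apply: ler_wpM2l; first exact: norm2_ge0.
  by apply: (le_trans (ler_norm c)); rewrite lerDl.
by rewrite ltxx.
Qed.

(** The subspace is that of the [z] with [d (T^n z) w = 0] for all [n], unless
    [T x = 0], when it may be trivial.  In that case the kernel of [T] is used, or
    any closed hyperplane if [T = 0]. *)
Lemma has_invariant_of_defect T x w :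
  (forall n, (0 < n)%N -> defect T (iter n T x) w = 0) ->
  defect T x w != 0 -> has_nontrivial_invariant_subspace T.
Proof.
move=> dn d0.
have [Tx|/eqP Tx] := eqVneq (T x) 0; last first.
  exists [set z | forall n, defect T (iter n T z) w = 0]; split.
  - split.
    + rewrite (_ : [set z | _] = \bigcap_n [set z | defect T (iter n T z) w = 0]).
        apply: closed_bigI => n _.
        apply: (@closed_zero_set _ (2 * norm2 w)) => y z.
        have -> : defect T (iter n T y) w - defect T (iter n T z) w =
            defect T (iter n T (y - z)) w.
          have -> : iter n T y = iter n T (y - z) + iter n T z by rewrite -iterD subrK.
          by rewrite defectDl addrK.
        apply: (le_trans (normc_defect _ _ _)); rewrite mulrAC.
        apply: ler_wpM2l; first by rewrite mulr_ge0 ?norm2_ge0.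
        exact: iter_contraction.
      by apply/seteqP; split => z h n; [move=> _|]; apply: h.
    + move=> n; have -> : iter n T 0 = 0 by elim: n => // n IHn; rewrite iterS IHn linear0.
      by rewrite /defect linear0 !dot0l subrr.
    + move=> a u v Vu Vv n.
      have -> : iter n T (a *: u + v) = a *: iter n T u + iter n T v.
        by elim: n => // n IHn; rewrite !iterS IHn linearD linearZ_LR.
      by rewrite defectDl defectZl Vu Vv mulr0 addr0.
    + by move=> _ [z Vz <-] n; rewrite -iterSr; exact: Vz.
  - move=> V0; apply: Tx.
    have : [set z | forall n, defect T (iter n T z) w = 0] (T x).
      by move=> n; rewrite -iterSr; exact: dn.
    by rewrite V0.
  - move=> VT; have : [set z | forall n, defect T (iter n T z) w = 0] x.
      by rewrite VT.
    by move=> /(_ 0%N) /= h; rewrite h eqxx in d0.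
have x0 : x <> 0.
  by move=> x0; move: d0; rewrite x0 /defect linear0 !dot0l subrr eqxx.
have [[y Ty]|/forallNP T0] := pselect (exists y, T y <> 0).
  exists [set z | T z = 0]; split.
  - split.
    + rewrite (_ : [set z | _] = \bigcap_k [set z | T z k = 0]).
        apply: closed_bigI => k _; apply: (@closed_zero_set _ 1) => u v.
        rewrite mul1r -ell2B -linearB.
        by apply: (le_trans (normc_coord _ _)); exact: contraction.
      apply/seteqP; split=> [z Tz k _|z h].
        by rewrite /mkset (Tz : T z = 0) ell20.
      by apply: ell2_ext => k; exact: h.
    + exact: linear0.
    + by move=> a u v /= Tu Tv; rewrite linearD linearZ_LR Tu Tv scaler0 addr0.
    + by move=> _ [z /= Tz <-]; rewrite Tz linear0.
  - by move=> V0; apply: x0; have : [set z | T z = 0] x by []; rewrite V0.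
  - by move=> VT; apply: Ty; have : [set z | T z = 0] y by rewrite VT.
have {}T0 z : T z = 0 by apply: contrapT; exact: T0.
exists [set z | z 0%N = 0]; split.
- split => //.
  + by apply: (@closed_zero_set _ 1) => u v; rewrite mul1r -ell2B; exact: normc_coord.
  + by move=> a u v u0 v0; rewrite /mkset ell2D ell2Z u0 v0 mulr0 addr0.
  + by move=> _ [z _ <-]; rewrite T0.
- move=> V0; have : [set z : ell2 R | z 0%N = 0] (e_ 1%N) by rewrite /mkset basisE.
  rewrite V0 /= => /(congr1 (fun z : ell2 R => z 1%N)).
  by rewrite basisE eqxx ell20 => /eqP; rewrite oner_eq0.
- move=> VT; have : [set z : ell2 R | z 0%N = 0] (e_ 0%N) by rewrite VT.
  by rewrite /mkset basisE eqxx => /eqP; rewrite oner_eq0.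
Qed.

(** Square roots of the tolerances on the residuals; they also bound the moves
    of the vectors, whose total must stay well below the norm of a basis
    vector. *)
Definition step_size k : R := 100^-1 / 2 ^+ k.

Lemma step_size_gt0 k : 0 < step_size k.
Proof. by rewrite divr_gt0 ?invr_gt0 // exprn_gt0. Qed.

Lemma step_size_cvg0 : step_size @ \oo --> (0 : R).
Proof.
rewrite -[X in _ --> X](mulr0 (100^-1 : R)); apply: cvgMr.
rewrite [X in X @ _](_ : _ = fun n => (2^-1) ^+ n); last first.
  by apply/funext => n; rewrite exprVn.
by apply: cvg_expr; rewrite ger0_norm ?invr_ge0 // invf_lt1 // ltr1n.
Qed.

Let start_margin (a b c d p q : R) : a < 2^-1 -> b <= 2 * (2 * 100^-1) ->
  c * d <= 2 * (2 * 100^-1) * (1 + 2 * (2 * 100^-1)) -> p <= 2 * b ->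
  q <= 2 * c * d -> 1 - a <= q + p -> False.
Proof. by move=> *; lra. Qed.

(** In the limit the defects for [n >= 1] vanish, and that for [n = 0] does not:
    it starts at [1 - |T e_m|^2], and both vectors have moved by at most [4 / 100]. *)
Lemma limit_invariant T (x w : nat -> ell2 R) (N : nat -> nat) m :
  x 0%N = e_ m -> w 0%N = e_ m -> N 0%N = 0%N ->
  (forall k, norm2 (x k.+1 - x k) <= 2 * step_size k) ->
  (forall k, norm2 (w k.+1 - w k) <= 2 * step_size k) ->
  (forall k, residual T (x k) (w k) (N k) < step_size k ^+ 4) ->
  has_nontrivial_invariant_subspace T.
Proof.
move=> x0 w0 N0 xs ws res.
have [|lx lxE] := @geometric_cvg R x (2 * 100^-1).
  by move=> k; rewrite -mulrA; exact: xs.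
have [|lw lwE] := @geometric_cvg R w (2 * 100^-1).
  by move=> k; rewrite -mulrA; exact: ws.
have to_lim (u : nat -> ell2 R) l :
    (forall k, norm2 (l - u k) <= 2 * (2 * 100^-1) / 2 ^+ k) -> ell2_cvg \oo u l.
  move=> ul; apply: (@cvg_squeeze0 _ _ _ _ _ (fun k => 4 * step_size k)).
  - by move=> k; exact: norm2_ge0.
  - move=> k; rewrite norm2B; apply: (le_trans (ul k)); rewrite /step_size.
    by rewrite le_eqVlt; apply/orP; left; apply/eqP; ring.
  - rewrite -[X in _ --> X](mulr0 (4 : R)); apply: cvgMr; exact: step_size_cvg0.
have xl := to_lim _ _ lxE; have wl := to_lim _ _ lwE.
have Tc z : ell2_cvg \oo (fun _ : nat => T z) (T z) by exact: ell2_cvg_cst.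
apply: (@has_invariant_of_defect T lx lw).
  move=> n n0; apply: Normc.eq0_normc.
  pose f k := normc (defect T (iter n T (x k)) (w k)).
  have f1 : f @ \oo --> normc (defect T (iter n T lx) lw).
    apply: cvg_normc; apply: (cvg_defect Tc) => //.
    exact: (ell2_cvg_iter Tc n xl).
  have f0 : f @ \oo --> (0 : R).
    apply: (@cvg_squeeze0 _ _ _ _ _ (fun k => step_size k ^+ 2)).
    - by move=> k; exact: normc_ge0.
    - move=> k; rewrite -ler_sqr ?nnegrE ?normc_ge0 ?sqr_ge0 // -exprM.
      by apply: le_trans (ltW (res k)); exact: defect_residual.
    - by rewrite -[X in _ --> X](expr0n R 2); exact: (cvg_sqr step_size_cvg0).
  exact: (cvg_unique _ f1 f0).
apply/eqP => d0.
have := lxE 0%N; have := lwE 0%N; rewrite x0 w0 expr0 divr1 => dw dx.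
have := res 0%N; rewrite x0 w0 N0 /residual big_geq // add0r norm2_basis mulr1 /=.
rewrite /step_size expr0 divr1 => Te.
have E : defect T (e_ m) (e_ m) = - defect T (lx - e_ m) lw
    - defect T (e_ m) (lw - e_ m).
  rewrite -[lw in defect T (lx - e_ m) lw](subrK (e_ m)).
  have : defect T (lx - e_ m + e_ m) (lw - e_ m + e_ m) = 0 by rewrite !subrK.
  by rewrite defectDl !defectDr => h; rewrite -[LHS]subr0 -h; ring.
have := congr1 normc E; rewrite defectxx norm2_basis expr1n.
have Te1 : 0 <= 1 - norm2 (T (e_ m)) ^+ 2.
  rewrite subr_ge0; apply: (le_trans (ltW Te)).
  by rewrite exprn_ile1 ?invr_ge0 // invf_le1 // ler1n.
rewrite normc_real // => F.
have := le_normcD (- defect T (lx - e_ m) lw) (- defect T (e_ m) (lw - e_ m)).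
rewrite -F !normcN.
have := normc_defect T (lx - e_ m) lw.
have := normc_defect T (e_ m) (lw - e_ m).
have lw1 : norm2 lw <= 1 + 2 * (2 * 100^-1).
  have := norm2D_le (lw - e_ m) (e_ m); rewrite subrK norm2_basis => h.
  by apply: (le_trans h); rewrite [leRHS]addrC; apply: lerD; [exact: dw|].
rewrite norm2_basis mulr1.
have := ler_pM (norm2_ge0 _) (norm2_ge0 _) dx lw1.
have {}Te : norm2 (T (e_ m)) ^+ 2 < 2^-1.
  apply: (lt_le_trans Te).
  apply: (@le_trans _ _ (100^-1)); last by rewrite lef_pV2 ?posrE // ler_nat.
  by rewrite exprS ler_piMr ?invr_ge0 // exprn_ile1 ?invr_ge0 // invf_le1 // ler1n.
move=> h1 h2 h3 h4; exact: (start_margin Te dw h1 h2 h3 h4).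
Qed.

End invariant.

(** * The comeager set *)

Section countable_parameters.
Variable R : realType.
Implicit Types (x y z u v w : ell2 R) (T : pos_contraction R).

Local Notation normc := (@Normc.normc R).
Local Notation e_ := (@ell2_basis R).

Definition rat_complex (p : rat * rat) : R[i] := (ratr p.1 +i* ratr p.2)%C.

Definition rat_vec (s : seq (rat * rat)) : ell2 R :=
  trunc (fun k => rat_complex (nth (0, 0) s k)) (size s).

Lemma rat_complex_dense (z : R[i]) (e : R) : 0 < e ->
  exists p, normc (z - rat_complex p) <= e.
Proof.
move=> e0; case: z => a b.
have near (c : R) : exists q : rat, `|c - ratr q| < e / 2.
  have [|q] := @rat_in_itvoo R (c - e / 2) (c + e / 2).
    by have := divr_gt0 e0 (@ltr0n R 2); lra.
  rewrite in_itv /= => /andP[h1 h2]; exists q.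
  by rewrite ltr_norml; apply/andP; split; lra.
have [p hp] := near a; have [q hq] := near b; exists (p, q).
rewrite /rat_complex /=; move: (a - _) (b - _) hp hq => c d hc hd.
apply: (@le_trans _ _ (Num.sqrt ((`|c| + `|d|) ^+ 2))).
  apply: ler_wsqrtr; rewrite sqrrD !real_normK ?num_real //.
  by rewrite lerD2r lerDl mulrn_wge0 // mulr_ge0.
rewrite sqrtr_sqr ger0_norm ?addr_ge0 // [e]splitr.
by apply: lerD; exact: ltW.
Qed.

Lemma rat_vec_dense x (e : R) : 0 < e -> exists s, norm2 (x - rat_vec s) < e.
Proof.
move=> e0; have e2 : 0 < e / 2 by rewrite divr_gt0.
have [m hm] := norm2_tail_small x e2.
have d0 : 0 < e / 2 / m.+1%:R by rewrite divr_gt0.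
have [f fP] := choice (fun k => rat_complex_dense (x k) d0).
exists (mkseq f m).
have -> : x - rat_vec (mkseq f m) = (x - trunc x m)
    + trunc (fun k => x k - rat_complex (f k)) m.
  apply: ell2_ext => k; rewrite [LHS]ell2B [RHS]ell2D ell2B !truncE size_mkseq.
  by case: ifP => km; rewrite ?nth_mkseq // ?subr0 ?addr0 // subrKA.
apply: (le_lt_trans (norm2D_le _ _)); rewrite [e]splitr.
apply: ltr_leD; first exact: hm.
apply: (le_trans (norm2_trunc_le_sum _ _)).
apply: (@le_trans _ _ (\sum_(0 <= k < m) (e / 2 / m.+1%:R))).
  by apply: ler_sum => k _; exact: fP.
rewrite sumr_const_nat subn0 -[leLHS]mulr_natl mulrCA.
apply: ler_piMr; first exact: ltW.
by rewrite ler_pdivrMr // mul1r ler_nat.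
Qed.

Lemma rat_vec_basis m : rat_vec (rcons (nseq m (0, 0)) (1, 0)) = e_ m.
Proof.
apply: ell2_ext => k; rewrite truncE size_rcons size_nseq basisE ltnS.
rewrite nth_rcons size_nseq nth_nseq leq_eqVlt.
have [->|km] := eqVneq k m.
  by rewrite ltnn /= /rat_complex /= rmorph1 rmorph0.
case: (k < m)%N => //=; rewrite /rat_complex /= rmorph0 //.
Qed.

Lemma rat_vec_supp s : trunc (rat_vec s) (size s) = rat_vec s.
Proof. exact: trunc_trunc. Qed.

Lemma rat_vec_seq x : exists s : nat -> seq (rat * rat),
  ell2_cvg \oo (fun j => rat_vec (s j)) x.
Proof.
have d0 (j : nat) : 0 < j.+1%:R^-1 :> R by rewrite invr_gt0.
have [s sP] := choice (fun j => rat_vec_dense x (d0 j)); exists s.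
apply: (@cvg_squeeze0 _ _ _ _ _ (fun j => j.+1%:R^-1)).
- by move=> j; exact: norm2_ge0.
- by move=> j; rewrite norm2B ltW.
- exact: cvg_harmonic.
Qed.

(** The data of an approximate solution: a level, the rational coordinates of two
    vectors, and the number of powers that are controlled. *)
Definition datum : Type := (nat * (seq (rat * rat) * seq (rat * rat)) * nat)%type.

Definition level (i : datum) := i.1.1.
Definition vec1 (i : datum) := rat_vec i.1.2.1.
Definition vec2 (i : datum) := rat_vec i.1.2.2.
Definition powers (i : datum) := i.2.

(** The exponent 4 is that of [cancel_defects]: the vector that cancels defects of
    square sum [eta^4] has norm [eta] when it is paired with [eta e_m]. *)
Definition good (i : datum) : set (pos_contraction R) :=
  [set T : pos_contraction R |
    residual T (vec1 i) (vec2 i) (powers i) < @step_size R (level i) ^+ 4].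

Definition initial : set datum := [set i |
  exists m, [/\ level i = 0%N, vec1 i = e_ m, vec2 i = e_ m & powers i = 0%N]].

(** The factor 2 leaves room for the rational approximation of the vectors
    given by [extension_step]. *)
Definition successor (i j : datum) : Prop := [/\ level j = (level i).+1,
  norm2 (vec1 j - vec1 i) <= 2 * @step_size R (level i) &
  norm2 (vec2 j - vec2 i) <= 2 * @step_size R (level i)].

Lemma good_open i : @open (SOTstar R) (good i).
Proof. exact: residual_open. Qed.

Lemma good_start T0 n (e : R) : 0 < e ->
  exists2 i, initial i & (sotball T0 n e `&` good i) !=set0.
Proof.
move=> e0; have [T [m [Tb Te]]] := start_step T0 n e0.
pose s : seq (rat * rat) := rcons (nseq m (0, 0)) (1, 0).
exists (0%N, (s, s), 0%N).
  by exists m; split; rewrite // /vec1 /vec2 /= /s rat_vec_basis.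
exists T; split => //; rewrite /good /mkset /vec1 /vec2 [(_, _, _).1.2.1]/= /s.
rewrite [(_, _, _).1.2.2]/= rat_vec_basis /residual big_geq // add0r iterS Te.
by rewrite norm2_0 mul0r expr0n exprn_gt0 // step_size_gt0.
Qed.

Lemma good_extend i T0 n (e : R) : 0 < e -> sotball T0 n e `<=` good i ->
  exists2 j, successor i j & (sotball T0 n e `&` good j) !=set0.
Proof.
move=> e0 sub; set k := level i.
have eta0 := @step_size_gt0 R k.
have eps0 : 0 < @step_size R k.+1 ^+ 4 by rewrite exprn_gt0 // step_size_gt0.
pose M := maxn (size i.1.2.1) (size i.1.2.2).
have xM := trunc_id (leq_maxl _ _ : size i.1.2.1 <= M)%N (rat_vec_supp i.1.2.1).
have wM := trunc_id (leq_maxr _ _ : size i.1.2.2 <= M)%N (rat_vec_supp i.1.2.2).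
have [T [x [w [N [Tb res xi wi]]]]] := extension_step xM wM e0 eta0 eps0 sub.
have [s sx] := rat_vec_seq x; have [t tw] := rat_vec_seq w.
have Tc z : ell2_cvg \oo (fun _ : nat => T z) (T z) by exact: ell2_cvg_cst.
have h1 : \forall j \near \oo,
    residual T (rat_vec (s j)) (rat_vec (t j)) N < @step_size R k.+1 ^+ 4.
  have rc : residual T (rat_vec (s j)) (rat_vec (t j)) N @[j --> \oo]
    --> residual T x w N by exact: (@cvg_residual R _ _ _ _ _ Tc N _ _ _ _ sx tw).
  exact: (rc [set r : R | r < @step_size R k.+1 ^+ 4] (lt_nbhsl res)).
have move_small (u : nat -> ell2 R) y y' : ell2_cvg \oo u y ->
    norm2 (y - y') <= @step_size R k ->
    \forall j \near \oo, norm2 (u j - y') <= 2 * @step_size R k.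
  move=> /cvgrPdist_le /(_ _ eta0) uy yy'; apply: filterS uy => j.
  rewrite sub0r normrN ger0_norm ?norm2_ge0 // => h.
  by apply: (le_trans (norm2_triangle y _ _)); rewrite mulrDl mul1r lerD.
have [j [[g1 g2] g3]] := filter_ex (filterI (filterI h1 (move_small _ _ _ sx xi))
  (move_small _ _ _ tw wi)).
by exists (k.+1, (s j, t j), N); [split|exists T; split].
Qed.

End countable_parameters.

Theorem theorem1p7 (R : realType) (tau : Topological (pos_contraction R)) :
  let X : topologicalType := Topological.Pack tau in
  polish R X ->
  (@open (WOT R) : set (set (pos_contraction R))) `<=` @open X ->
  (@open X : set (set (pos_contraction R))) `<=` @open (SOTstar R) ->
  comeager (X := X)
    [set T : pos_contraction R | has_nontrivial_invariant_subspace T].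
Proof.
move=> X XR WX XS.
pose G (i : datum) : set X := (good (R := R) i : set X)^°.
have GE i : G i `<=` good i by exact: interior_subset.
(* The interiors for [tau] of the good sets meet every [tau]-open set that the
   good sets themselves meet. *)
have hit (V : set X) i : open V -> (V `&` good i) !=set0 -> (V `&` G i) !=set0.
  move=> oV [T [VT gT]].
  have oVg : @open (SOTstar R) (V `&` good i).
    by apply: (@openI (SOTstar R)); [exact: XS|exact: good_open].
  have [n [e [e0 sub]]] := SOTstar_sotball oVg (conj VT gT).
  have [W [oW [S WS] Wsub]] := WOT_open_in_sotball T n e0.
  exists S; split; first by have [] := sub S (Wsub S WS).
  rewrite /G /interior nbhsE; exists W; first by split => //; exact: WX.
  by move=> S' WS'; have [] := sub S' (Wsub S' WS').
have [D [DG Dd] Dsub] : comeager (X := X) [set T : X | exists c : nat -> datum,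
    [/\ @initial R (c 0%N), forall k, @successor R (c k) (c k.+1)
      & forall k, G (c k) T]].
  apply: (comeager_chain XR).
  - by move=> i; exact: open_interior.
  - move=> V oV [T0 VT0].
    have [n [e [e0 sub]]] := SOTstar_sotball (XS _ oV) VT0.
    have [i ii [T [Tb gT]]] := good_start T0 n e0.
    by exists i => //; apply: hit => //; exists T; split => //; exact: sub.
  - move=> i V oV [T0 VT0] VG.
    have [n [e [e0 sub]]] := SOTstar_sotball (XS _ oV) VT0.
    have [|j ij [T [Tb gT]]] := @good_extend R i T0 n e e0.
      by move=> S /sub /VG /GE.
    by exists j => //; apply: hit => //; exists T; split => //; exact: sub.
exists D => // T /Dsub[c [[m [l0 x0 w0 N0]] cs cG]].
have lev k : level (c k) = k.
  by elim: k => // k IHk; have [-> _ _] := cs k; rewrite IHk.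
apply: (@limit_invariant R T (fun k => vec1 R (c k)) (fun k => vec2 R (c k))
  (fun k => powers (c k)) m x0 w0 N0) => k.
- by have [_ + _] := cs k; rewrite lev.
- by have [_ _ +] := cs k; rewrite lev.
- by have := GE _ _ (cG k); rewrite /good /mkset lev.
Qed.
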